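(* Let $p$ be a prime and let $\mathsf{L}$ be a non-abelian free $\mathbb{F}_p$-Lie algebra on finitely many generators. Then there exists, for each $\alpha \in [0,1]$, a Lie subalgebra $\mathsf{M} \leq \mathsf{L}$ that can be generated freely by a suitable collection of basic commutators for $\mathsf{L}$ and satisfies $\mathrm{den}_{\mathsf{L}}(\mathsf{M}) = \alpha$. In particular, $\mathrm{dspec}(\mathsf{L}) = [0,1]$.
   Context: $\mathsf{L}$ is free on $\mathsf{x}_1,\ldots,\mathsf{x}_d$ with $d\ge2$, and carries its natural grading $\mathsf{L}=\bigoplus_{n\ge1}\mathsf{L}_n$, where $\mathsf{L}_n$ is spanned by Lie words of length $n$ in $\mathsf{x}_1,\ldots,\mathsf{x}_d$. Write $\mathsf{L}_{\ge n}=\bigoplus_{m\ge n}\mathsf{L}_m$ and $\mathsf{L}_{>n}=\mathsf{L}_{\ge n+1}$. The density of a Lie subalgebra $\mathsf{M}\le\mathsf{L}$ is $$\mathrm{den}_{\mathsf{L}}(\mathsf{M}) = \liminf_{n\to\infty} \frac{\dim_{\mathbb{F}_p}\big((\mathsf{M}+\mathsf{L}_{>n})/\mathsf{L}_{>n}\big)}{\dim_{\mathbb{F}_p}(\mathsf{L}/\mathsf{L}_{>n})},$$ and the density spectrum is $\mathrm{dspec}(\mathsf{L})=\{\mathrm{den}_{\mathsf{L}}(\mathsf{M})\mid \mathsf{M} \text{ a Lie subalgebra of }\mathsf{L}\}$. Basic commutators for $\mathsf{L}$ (with respect to $X=\{\mathsf{x}_1,\ldots,\mathsf{x}_d\}$)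 are defined inductively together with a well-order. Lie commutators have weight: $\mathrm{wt}(\mathsf{x}_i)=1$, $\mathrm{wt}([\mathsf{c}_1,\mathsf{c}_2])=\mathrm{wt}(\mathsf{c}_1)+\mathrm{wt}(\mathsf{c}_2)$ for $[\mathsf{c}_1,\mathsf{c}_2]\ne0$. The basic commutators of weight $1$ are the elements of $X$ in some well-order. For $n\ge2$, the basic commutators of weight $n$ are the Lie commutators $[\mathsf{u},\mathsf{v}]$ such that (1) $\mathsf{u},\mathsf{v}$ are basic commutators with $\mathrm{wt}(\mathsf{u})+\mathrm{wt}(\mathsf{v})=n$; (2) $\mathsf{u}>\mathsf{v}$, and if $\mathsf{u}=[\mathsf{y},\mathsf{z}]$ with basic commutators $\mathsf{y},\mathsf{z}$, then $\mathsf{v}\ge\mathsf{z}$. The order is extended so that $\mathsf{u}<\mathsf{v}$ whenever $\mathrm{wt}(\mathsf{u})<\mathrm{wt}(\mathsf{v})$, and arbitrarily among the new basic commutators of weight $n$. *)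

(* Defs.v *)
From HB Require Import structures.
From mathcomp Require Import all_boot all_order all_algebra.
From mathcomp Require Import all_classical all_reals all_analysis.
From mathcomp Require Import wochoice.

Set Implicit Arguments.
Unset Strict Implicit.
Unset Printing Implicit Defensive.

Import Order.TTheory GRing.Theory Num.Theory.

Local Open Scope classical_set_scope.
Local Open Scope ring_scope.

HB.mixin Record isLieAlgebra (F : fieldType) L of GRing.Lmodule F L := {
  lie : L -> L -> L;
  lie_linearl : forall w a u v, lie (a *: u + v) w = a *: lie u w + lie v w;
  lie_linearr : forall w a u v, lie w (a *: u + v) = a *: lie w u + lie w v;
  liexx : forall u, lie u u = 0;
  lie_jacobi : forall u v w,
    lie u (lie v w) + lie v (lie w u) + lie w (lie u v) = 0
}.

#[short(type="lieAlgType")]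
HB.structure Definition LieAlgebra (F : fieldType) :=
  { L of GRing.Lmodule F L & isLieAlgebra F L }.

Section Subspaces.
Variables (F : fieldType) (V : lmodType F).

Definition lin_subspace (A : set V) : Prop := submod_closed [in A].

Definition lin_span (G : set V) : set V := smallest lin_subspace G.

Definition sum_set (A B : set V) : set V := [set u + v | u in A & v in B].

(* The cosets e i + B form a basis of the quotient space A / B,
   where B is a subspace of A. *)
Definition quot_basis (A B : set V) k (e : 'I_k -> V) : Prop :=
  [/\ forall i, A (e i),
      forall v, A v -> exists c : 'I_k -> F, B (v - \sum_(i < k) c i *: e i)
    & forall c : 'I_k -> F,
        B (\sum_(i < k) c i *: e i) -> forall i, c i = 0].

(* dim (A / B); the junk value is 0 when A / B is infinite-dimensional. *)
Definition quot_dim (A B : set V) : nat :=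
  xget 0%N [set k | exists e : 'I_k -> V, quot_basis A B e].

End Subspaces.

Section LieSubalgebras.
Variables (F : fieldType) (L : lieAlgType F).

Definition lie_subalg (M : set L) : Prop :=
  lin_subspace M /\ forall u v, M u -> M v -> M (lie u v).

Definition lie_gen (G : set L) : set L := smallest lie_subalg G.

(* The restriction of f to the subalgebra M is a Lie algebra homomorphism;
   the values of f outside M are irrelevant. *)
Definition lie_hom_on (M : set L) (K : lieAlgType F) (f : L -> K) : Prop :=
  (forall a u v, M u -> M v -> f (a *: u + v) = a *: f u + f v) /\
  (forall u v, M u -> M v -> f (lie u v) = lie (f u) (f v)).

(* The Lie algebra M is free on the family (e i), i in D: every map from D to
   a Lie algebra K extends uniquely to a homomorphism from M to K. *)
Definition free_on (M : set L) (I : Type) (D : set I) (e : I -> L) : Prop :=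
  [/\ lie_subalg M,
      forall i, D i -> M (e i)
    & forall (K : lieAlgType F) (y : I -> K),
      exists f : L -> K,
        [/\ lie_hom_on M f,
            forall i, D i -> f (e i) = y i
          & forall g : L -> K, lie_hom_on M g ->
              (forall i, D i -> g (e i) = y i) ->
              forall u, M u -> g u = f u]].

End LieSubalgebras.

(* Formal Lie commutators in d letters. *)
Inductive liecomm (d : nat) : Type :=
| Gen of 'I_d
| Br of liecomm d & liecomm d.

Section Commutators.
Variable d : nat.
Implicit Types (u v t : liecomm d).

Fixpoint wt t : nat :=
  match t with
  | Gen _ => 1
  | Br u v => wt u + wt v
  end.

Fixpoint lie_eval (F : fieldType) (L : lieAlgType F) (x : 'I_d -> L) t : L :=
  match t with
  | Gen i => x i
  | Br u v => lie (lie_eval x u) (lie_eval x v)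
  end.

(* Only the restriction of le to basic commutators of weight less than wt t is
   relevant for basic le t, so that basic commutators and their order le can be
   built up simultaneously by induction on the weight; u > v is ~~ le u v. *)
Fixpoint basic (le : rel (liecomm d)) t : bool :=
  match t with
  | Gen _ => true
  | Br u v =>
      [&& basic le u, basic le v, ~~ le u v
        & (if u is Br _ z then le z v else true)]
  end.

Definition basic_order (le : rel (liecomm d)) : Prop :=
  wo_chain le (basic le) /\
  forall u v, basic le u -> basic le v -> (wt u < wt v)%N -> ~~ le v u.

End Commutators.

Section Density.
Variables (F : fieldType) (L : lieAlgType F) (d : nat) (x : 'I_d -> L).

Definition lie_homog (n : nat) : set L :=
  lin_span [set lie_eval x t | t in [set t | wt t = n]].

Definition lie_ge (n : nat) : set L :=
  lin_span (\bigcup_(m in [set m | (n <= m)%N]) lie_homog m).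

Definition lie_gt (n : nat) : set L := lie_ge n.+1.

Definition den (R : realType) (M : set L) : R :=
  limn_inf (fun n => (quot_dim (sum_set M (lie_gt n)) (lie_gt n))%:R
                     / (quot_dim [set: L] (lie_gt n))%:R).

Definition dspec (R : realType) : set R :=
  [set den R M | M in [set M | lie_subalg M]].

End Density.

Arguments den {F L d} x R M.
Arguments dspec {F L d} x R _.

(* Main.v *)
(* Fix the codimension in advance, weight by weight.  A finite-codimensional
   homogeneous subalgebra M_n of L containing all elements of weight > n, free on
   a homogeneous set G_n, is refined as follows: modulo the other generators the
   generators of weight n + 1 can be exchanged for basic commutators, since these
   span the homogeneous part of weight n + 1; some of them are then removed by
   Lazard elimination, which replaces c by the elements ad(c)^k z, k >= 1.  The
   intersection of the M_n is generated freely by the basic commutators that are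
   never removed.

   One letter is removed first, and from then on as many generators as possible
   are removed in each weight subject to dim M_{<= n} >= alpha dim L_{<= n}.
   The lower limit of the quotients can only exceed alpha if from some weight on
   all generators are removed, i.e. if M has a finite set S of free generators.
   In that case the sum of d^(-wt s) over S is less than 1, so that M grows
   exponentially at a rate less than d, whereas L does not. *)

Require Import Defs.
From HB Require Import structures.
From mathcomp Require Import all_boot all_order all_algebra.
From mathcomp Require Import all_classical all_reals all_analysis.
From mathcomp Require Import wochoice zify ring lra.

Set Implicit Arguments.
Unset Strict Implicit.
Unset Printing Implicit Defensive.

Import Order.TTheory GRing.Theory Num.Theory.

Local Open Scope classical_set_scope.
Local Open Scope ring_scope.

(** * Subspaces, Lie identities, generated subalgebras *)

(** Freeness after an elimination rests on a universal property: the required homomorphisms come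
    from a semidirect product in which a derivation acts on sequences, and its bracket must not
    divide by factorials, since these vanish in [F_p]. Growth is read off from truncations of the
    series 1 - sum g_m t^m, because infinite families occur and bounds are needed weight by weight.
    Eliminating a generator of weight n divides the series by 1 - t^n, so truncations that are
    nonnegative never decrease for 0 < t < 1.

    The point t = 1/d is the zero of the series 1 - d t of the letters. There the truncations for
    the letters add up to 1, while up to weight n they add up to n + 1 once no generator of weight
    at most n is left; comparing both for the elimination of everything forces [L] to be large. The
    removed letter matters at the same point: for all letters the truncations in positive weights
    are 0, but after the removal the truncation at weight M is at least d^(-M), which leaves room to
    move t slightly beyond 1/d. *)

Section Subspaces.
Variables (F : fieldType) (V : lmodType F).
Implicit Types (A B G : set V).

Lemma lin_subspaceP A :
  lin_subspace A <-> A 0 /\ forall a u v, A u -> A v -> A (a *: u + v).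
Proof.
split=> [[A0 AZ]|[A0 AZ]]; split=> //.
- by move: A0; rewrite inE.
- by move=> a u v Au Av; have := AZ a u v; rewrite !inE; apply.
- by rewrite inE.
- by move=> a u v; rewrite !inE; exact: AZ.
Qed.

Lemma lin_subspace0 A : lin_subspace A -> A 0.
Proof. by move=> /lin_subspaceP[]. Qed.

Lemma lin_subspaceZ A a u : lin_subspace A -> A u -> A (a *: u).
Proof.
by move=> /lin_subspaceP[A0 AZ] Au; rewrite -[_ *: _]addr0; exact: AZ.
Qed.

Lemma lin_subspaceD A u v : lin_subspace A -> A u -> A v -> A (u + v).
Proof.
by move=> /lin_subspaceP[A0 AZ] Au Av; rewrite -[u]scale1r; exact: AZ.
Qed.

Lemma lin_subspaceN A u : lin_subspace A -> A u -> A (- u).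
Proof. by move=> sA; rewrite -scaleN1r; exact: lin_subspaceZ. Qed.

Lemma lin_subspaceB A u v : lin_subspace A -> A u -> A v -> A (u - v).
Proof. by move=> sA Au /(lin_subspaceN sA); exact: lin_subspaceD. Qed.

Lemma lin_subspace_sum A (I : Type) (r : seq I) (P : pred I) (f : I -> V) :
  lin_subspace A -> (forall i, P i -> A (f i)) -> A (\sum_(i <- r | P i) f i).
Proof.
move=> sA Af; apply: (big_ind A); first exact: lin_subspace0.
- by move=> u v; exact: lin_subspaceD.
- by move=> i; exact: Af.
Qed.

Lemma lin_span_subspace G : lin_subspace (lin_span G).
Proof.
apply/lin_subspaceP; split=> [A [sA _]|a u v Gu Gv A [sA GA]].
  exact: lin_subspace0.
apply: lin_subspaceD => //; first apply: lin_subspaceZ => //.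
  by apply: Gu.
by apply: Gv.
Qed.

Lemma lin_span_sub G : G `<=` lin_span G.
Proof. by move=> u Gu A [_]; exact. Qed.

Lemma lin_span_min G A : lin_subspace A -> G `<=` A -> lin_span G `<=` A.
Proof. by move=> sA GA u; apply. Qed.

Lemma sum_set_subspace A B :
  lin_subspace A -> lin_subspace B -> lin_subspace (sum_set A B).
Proof.
move=> sA sB; apply/lin_subspaceP; split.
  exists 0; first exact: lin_subspace0.
  by exists 0; [exact: lin_subspace0|rewrite addr0].
move=> a _ _ [u1 Au1 [v1 Bv1 <-]] [u2 Au2 [v2 Bv2 <-]].
exists (a *: u1 + u2); first by apply: lin_subspaceD => //; exact: lin_subspaceZ.
exists (a *: v1 + v2); first by apply: lin_subspaceD => //; exact: lin_subspaceZ.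
by rewrite scalerDr addrACA.
Qed.

Lemma sum_setl A B : lin_subspace B -> A `<=` sum_set A B.
Proof.
move=> sB u Au; exists u => //; exists 0; first exact: lin_subspace0.
by rewrite addr0.
Qed.

Lemma sum_setr A B : lin_subspace A -> B `<=` sum_set A B.
Proof.
move=> sA u Bu; exists 0; first exact: lin_subspace0.
by exists u => //; rewrite add0r.
Qed.

End Subspaces.

Section LieIdentities.
Variables (F : fieldType) (L : lieAlgType F).
Implicit Types (u v w : L).

Lemma lieDl w u v : lie (u + v) w = lie u w + lie v w.
Proof. by rewrite -[u]scale1r lie_linearl !scale1r. Qed.

Lemma lieDr w u v : lie w (u + v) = lie w u + lie w v.
Proof. by rewrite -[u]scale1r lie_linearr !scale1r. Qed.

Lemma lie0l w : lie 0 w = 0.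
Proof. by apply: (addrI (lie 0 w)); rewrite -lieDl !addr0. Qed.

Lemma lie0r w : lie w 0 = 0.
Proof. by apply: (addrI (lie w 0)); rewrite -lieDr !addr0. Qed.

Lemma lieZl a u w : lie (a *: u) w = a *: lie u w.
Proof. by rewrite -[_ *: u]addr0 lie_linearl lie0l addr0. Qed.

Lemma lieZr a u w : lie w (a *: u) = a *: lie w u.
Proof. by rewrite -[_ *: u]addr0 lie_linearr lie0r addr0. Qed.

Lemma lieNr u w : lie w (- u) = - lie w u.
Proof. by rewrite -scaleN1r lieZr scaleN1r. Qed.

Lemma lieC u v : lie u v = - lie v u.
Proof.
apply/eqP; rewrite -addr_eq0; apply/eqP.
by have := liexx (u + v); rewrite lieDl !lieDr !liexx add0r addr0.
Qed.

Lemma lie_derl w u v : lie w (lie u v) = lie (lie w u) v + lie u (lie w v).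
Proof.
have := lie_jacobi w u v; rewrite -addrA => /eqP; rewrite addr_eq0 => /eqP ->.
by rewrite opprD [lie v (lie w u)]lieC [lie v w]lieC lieNr !opprK addrC.
Qed.

End LieIdentities.

Section Generation.
Variables (F : fieldType) (L : lieAlgType F).
Implicit Types (M G A : set L).

Lemma lie_subalg_intro M : M 0 ->
  (forall a u v, M u -> M v -> M (a *: u + v)) ->
  (forall u v, M u -> M v -> M (lie u v)) -> lie_subalg M.
Proof. by move=> M0 MZ Ml; split=> //; apply/lin_subspaceP. Qed.

Lemma lie_subalgT : lie_subalg [set: L].
Proof. exact: lie_subalg_intro. Qed.

Lemma lie_gen_subalg G : lie_subalg (lie_gen G).
Proof.
apply: lie_subalg_intro.
- by move=> A [[sA _] _]; exact: lin_subspace0.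
- move=> a u v Gu Gv A AG; have [[sA _] _] := AG.
  by apply: lin_subspaceD => //; [apply: lin_subspaceZ => //; apply: Gu|apply: Gv].
- by move=> u v Gu Gv A AG; have [[_ lA] _] := AG; apply: lA; [apply: Gu|apply: Gv].
Qed.

Lemma lie_gen_subspace G : lin_subspace (lie_gen G).
Proof. by case: (lie_gen_subalg G). Qed.

Lemma lie_gen_lie G u v : lie_gen G u -> lie_gen G v -> lie_gen G (lie u v).
Proof. by case: (lie_gen_subalg G) => _; exact. Qed.

Lemma lie_gen_sub G : G `<=` lie_gen G.
Proof. by move=> u Gu A [_]; exact. Qed.

Lemma lie_gen_min G A : lie_subalg A -> G `<=` A -> lie_gen G `<=` A.
Proof. by move=> sA GA u; apply. Qed.

Lemma lie_gen_mono G A : G `<=` lie_gen A -> lie_gen G `<=` lie_gen A.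
Proof. by move=> GA; apply: lie_gen_min => //; exact: lie_gen_subalg. Qed.

Lemma lie_genS G A : G `<=` A -> lie_gen G `<=` lie_gen A.
Proof. by move=> GA; apply: lie_gen_mono => u /GA; exact: lie_gen_sub. Qed.

Lemma lie_gen_ind G (P : L -> Prop) :
  P 0 -> (forall u, G u -> P u) ->
  (forall a u v, lie_gen G u -> lie_gen G v -> P u -> P v -> P (a *: u + v)) ->
  (forall u v, lie_gen G u -> lie_gen G v -> P u -> P v -> P (lie u v)) ->
  forall u, lie_gen G u -> P u.
Proof.
move=> P0 PG PZ Pl u Gu.
suff: lie_gen G u /\ P u by case.
apply: (lie_gen_min (A := [set u | lie_gen G u /\ P u])) Gu.
  apply: lie_subalg_intro.
  - by split=> //; exact: (lin_subspace0 (lie_gen_subspace G)).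
  - move=> a v w [Gv Pv] [Gw Pw]; split; last exact: PZ.
    have sG := lie_gen_subspace G.
    exact: (lin_subspaceD sG (lin_subspaceZ a sG Gv) Gw).
  - by move=> v w [Gv Pv] [Gw Pw]; split; [exact: lie_gen_lie|exact: Pl].
by move=> v Gv; split; [exact: lie_gen_sub|exact: PG].
Qed.

Lemma lie_subalg_sum_ideal M A : lie_subalg M -> lin_subspace A ->
  (forall u v, A v -> A (lie u v)) -> lie_subalg (sum_set M A).
Proof.
move=> [sM lM] sA iA; split; first exact: sum_set_subspace.
move=> _ _ [u1 Mu1 [v1 Av1 <-]] [u2 Mu2 [v2 Av2 <-]].
exists (lie u1 u2); first exact: lM.
exists (lie u1 v2 + lie v1 (u2 + v2)); last first.
  by rewrite lieDl [lie u1 (_ + _)]lieDr addrA.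
apply: lin_subspaceD => //; first exact: iA.
by rewrite lieC; apply: lin_subspaceN => //; exact: iA.
Qed.

Section Homomorphisms.
Variable K : lieAlgType F.
Implicit Types (f g : L -> K).

Lemma lie_hom0 M f : lie_subalg M -> lie_hom_on M f -> f 0 = 0.
Proof.
move=> [sM _] [fZ _]; have := fZ (-1) 0 0 (lin_subspace0 sM) (lin_subspace0 sM).
by rewrite scaler0 add0r scaleN1r addNr.
Qed.

Lemma lie_homS M A f : A `<=` M -> lie_hom_on M f -> lie_hom_on A f.
Proof. by move=> AM [fZ fl]; split=> *; [apply: fZ|apply: fl]; exact: AM. Qed.

Lemma lie_hom_eq G f g :
  lie_hom_on (lie_gen G) f -> lie_hom_on (lie_gen G) g ->
  (forall u, G u -> f u = g u) -> forall u, lie_gen G u -> f u = g u.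
Proof.
move=> hf hg fg; have sG := lie_gen_subalg G.
apply: (@lie_gen_ind _ (fun u => f u = g u)) => //.
- by rewrite (lie_hom0 sG hf) (lie_hom0 sG hg).
- by move=> a u v Gu Gv fu fv; rewrite hf.1// hg.1// fu fv.
- by move=> u v Gu Gv fu fv; rewrite hf.2// hg.2// fu fv.
Qed.

End Homomorphisms.

(* Uniqueness of the extension is automatic on [lie_gen G], so existence is
   all there is to freeness. *)
Definition lie_free G : Prop :=
  forall (K : lieAlgType F) (y : L -> K),
    exists f : L -> K, lie_hom_on (lie_gen G) f /\ forall u, G u -> f u = y u.

End Generation.

(** * Auxiliary Lie algebras *)

(** Homomorphisms into this algebra read off coefficients of generators. The new name keeps the zero
    bracket from being attached to [F^o] itself. *)
Definition abelian_lie (F : fieldType) : Type := F^o.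

HB.instance Definition _ (F : fieldType) :=
  GRing.Lmodule.copy (abelian_lie F) F^o.

Section AbelianLie.
Variable F : fieldType.
Let A := abelian_lie F.

Definition abelian_br (u v : A) : A := 0.

Fact abelian_linearl (w : A) (a : F) (u v : A) :
  abelian_br (a *: u + v) w = a *: abelian_br u w + abelian_br v w.
Proof. by rewrite /abelian_br scaler0 addr0. Qed.

Fact abelian_linearr (w : A) (a : F) (u v : A) :
  abelian_br w (a *: u + v) = a *: abelian_br w u + abelian_br w v.
Proof. by rewrite /abelian_br scaler0 addr0. Qed.

Fact abelian_brxx (u : A) : abelian_br u u = 0. Proof. by []. Qed.

Fact abelian_jacobi (u v w : A) :
  abelian_br u (abelian_br v w) + abelian_br v (abelian_br w u) +
  abelian_br w (abelian_br u v) = 0.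
Proof. by rewrite /abelian_br !addr0. Qed.

HB.instance Definition _ := isLieAlgebra.Build F (abelian_lie F)
  abelian_linearl abelian_linearr abelian_brxx abelian_jacobi.

End AbelianLie.

(** * Hurwitz sequences and the derivation given by the shift *)

Section HurwitzBracket.
Variables (F : fieldType) (K : lieAlgType F).
Implicit Types (a b c : nat -> K) (n : nat).

Definition shift a : nat -> K := fun n => a n.+1.

(* The bracket of "exponential generating series": it makes [shift] a derivation
   in every characteristic, and taking the term of index 0 a homomorphism. *)
Fixpoint hurwitz n a b : K :=
  if n is n'.+1 then hurwitz n' (shift a) b + hurwitz n' a (shift b)
  else lie (a 0%N) (b 0%N).

Lemma shift_linear t a b : shift (t *: a + b) = t *: shift a + shift b.
Proof. by []. Qed.

Lemma hurwitz_linearl n c t a b :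
  hurwitz n (t *: a + b) c = t *: hurwitz n a c + hurwitz n b c.
Proof.
elim: n a b c => [|n IH] a b c /=; first by rewrite lie_linearl.
by rewrite shift_linear !IH scalerDr addrACA.
Qed.

Lemma hurwitz_linearr n c t a b :
  hurwitz n c (t *: a + b) = t *: hurwitz n c a + hurwitz n c b.
Proof.
elim: n a b c => [|n IH] a b c /=; first by rewrite lie_linearr.
by rewrite shift_linear !IH scalerDr addrACA.
Qed.

Lemma hurwitz0l n b : hurwitz n 0 b = 0.
Proof.
elim: n b => [|n IH] b /=; first by rewrite lie0l.
by rewrite -[shift 0]/(0 : nat -> K) !IH addr0.
Qed.

Lemma hurwitzC n a b : hurwitz n a b = - hurwitz n b a.
Proof.
elim: n a b => [|n IH] a b /=; first by rewrite lieC.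
by rewrite IH [hurwitz n a _]IH opprD addrC.
Qed.

Lemma hurwitzxx n a : hurwitz n a a = 0.
Proof. by case: n => [|n] /=; rewrite ?liexx// hurwitzC addNr. Qed.

Let hbr a b : nat -> K := fun n => hurwitz n a b.

Lemma shift_hurwitz a b :
  shift (hbr a b) = 1 *: hbr (shift a) b + hbr a (shift b).
Proof. by rewrite scale1r. Qed.

(** As [shift] is a derivation, the Jacobi sum at [n.+1] is the sum of three Jacobi sums at [n],
    each with one argument shifted. *)
Lemma hurwitz_jacobi n a b c :
  hurwitz n a (hbr b c) + hurwitz n b (hbr c a) + hurwitz n c (hbr a b) = 0.
Proof.
elim: n a b c => [|n IH] a b c /=; first exact: lie_jacobi.
rewrite !shift_hurwitz !hurwitz_linearr !scale1r.
have := congr2 +%R (IH (shift a) b c) (congr2 +%R (IH a (shift b) c) (IH a b (shift c))).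
rewrite !addr0 => <-.
by rewrite (AC ((1*2)*(1*2)*(1*2)) ((1*6*8)*((2*4*9)*(3*5*7)))).
Qed.

End HurwitzBracket.

Definition shift_ext (F : fieldType) (K : lieAlgType F) : Type :=
  (F^o * (nat -> K))%type.

HB.instance Definition _ (F : fieldType) (K : lieAlgType F) :=
  GRing.Lmodule.copy (shift_ext K) (F^o * (nat -> K))%type.

Section ShiftExtension.
Variables (F : fieldType) (K : lieAlgType F).
Let E := shift_ext K.

(* The semidirect product of the line spanned by the derivation [shift] and
   the Hurwitz sequences. *)
Definition shift_br (u v : E) : E :=
  (0, fun n =>
    (u.1 : F) *: v.2 n.+1 - (v.1 : F) *: u.2 n.+1 + hurwitz n u.2 v.2).

Fact shift_brE u v n :
  (shift_br u v).2 n =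
    (u.1 : F) *: v.2 n.+1 - (v.1 : F) *: u.2 n.+1 + hurwitz n u.2 v.2.
Proof. by []. Qed.

Fact shift_ext_eq (u v : E) : u.1 = v.1 -> (forall n, u.2 n = v.2 n) -> u = v.
Proof. by case: u v => [a f] [b g] /= -> /funext ->. Qed.

Fact shift_linearl (w : E) (a : F) (u v : E) :
  shift_br (a *: u + v) w = a *: shift_br u w + shift_br v w.
Proof.
apply: shift_ext_eq => [|n]; first by rewrite /= scaler0 addr0.
rewrite -[RHS]/(a *: (shift_br u w).2 n + (shift_br v w).2 n) !shift_brE.
rewrite -[_.1]/(a * (u.1 : F) + v.1) -[X in _ - _ *: X]/(a *: u.2 n.+1 + v.2 n.+1).
rewrite hurwitz_linearl scalerDl !scalerDr !scalerA !scalerN !scalerA.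
by rewrite [w.1 * a]mulrC opprD (AC ((2*2)*2) ((1*3*5)*(2*4*6))).
Qed.

Fact shift_brC (u v : E) : shift_br u v = - shift_br v u.
Proof.
apply: shift_ext_eq => [|n]; first by rewrite /= oppr0.
rewrite -[RHS]/(- (shift_br v u).2 n) !shift_brE.
by rewrite hurwitzC !opprD opprK [- _ + _]addrC.
Qed.

Fact shift_linearr (w : E) (a : F) (u v : E) :
  shift_br w (a *: u + v) = a *: shift_br w u + shift_br w v.
Proof. by rewrite ![shift_br w _]shift_brC shift_linearl scalerN opprD. Qed.

Fact shift_brxx (u : E) : shift_br u u = 0.
Proof.
by apply: shift_ext_eq => [//|n]; rewrite shift_brE hurwitzxx subrr addr0.
Qed.

Fact hurwitz_shift_br n (c : nat -> K) (u v : E) :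
  hurwitz n c (shift_br u v).2 =
  (u.1 : F) *: hurwitz n c (shift v.2) - (v.1 : F) *: hurwitz n c (shift u.2) +
  hurwitz n c (fun m => hurwitz m u.2 v.2).
Proof.
have -> : (shift_br u v).2 = (u.1 : F) *: (shift v.2 : nat -> K) +
    (- (v.1 : F) *: (shift u.2 : nat -> K) +
      1 *: (fun m => hurwitz m u.2 v.2)) :> (nat -> K).
  apply/funext => m; rewrite shift_brE scale1r scaleNr.
  by rewrite -addrA.
by rewrite !hurwitz_linearr scale1r scaleNr addrA.
Qed.

(** Grouped for the cyclic sum: each of the three differences cancels around the cycle by
    [cyclic_sub_eq0], and the last term leads to [hurwitz_jacobi]. *)
Fact shift_br2E (u v w : E) n : (shift_br u (shift_br v w)).2 n =
  ((((u.1 : F) * v.1) *: w.2 n.+2 - ((w.1 : F) * u.1) *: v.2 n.+2) +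
   ((u.1 : F) *: hurwitz n v.2 (shift w.2) -
    (w.1 : F) *: hurwitz n u.2 (shift v.2))) +
  (((v.1 : F) *: hurwitz n u.2 (shift w.2) -
    (u.1 : F) *: hurwitz n w.2 (shift v.2)) +
   hurwitz n u.2 (fun m => hurwitz m v.2 w.2)).
Proof.
rewrite shift_brE hurwitz_shift_br !shift_brE scale0r subr0 /=.
rewrite !scalerDr !scalerN !scalerA [hurwitz n (shift v.2) _]hurwitzC scalerN.
rewrite [_ * (u.1 : F)]mulrC.
by rewrite (AC (((2*2)*(2*1))) ((1*2)*(4*6)*((5*3)*7))).
Qed.

Fact cyclic_sub_eq0 (V : zmodType) (x y z : V) : (x - z) + (y - x) + (z - y) = 0.
Proof. by rewrite addrC [_ + (y - x)]addrC !addrA !subrK subrr. Qed.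

Fact shift_jacobi (u v w : E) :
  shift_br u (shift_br v w) + shift_br v (shift_br w u) +
  shift_br w (shift_br u v) = 0.
Proof.
apply: shift_ext_eq => [|n]; first by rewrite /= !addr0.
rewrite -[LHS]/((shift_br u (shift_br v w)).2 n +
  (shift_br v (shift_br w u)).2 n + (shift_br w (shift_br u v)).2 n).
rewrite !shift_br2E (AC ((2*2)*(2*2)*(2*2)) ((1*5*9)*(2*6*10)*(3*7*11)*(4*8*12))).
rewrite [X in _ + X = _](hurwitz_jacobi n u.2 v.2 w.2) addr0 /=.
by rewrite !cyclic_sub_eq0 !addr0.
Qed.

HB.instance Definition _ := isLieAlgebra.Build F (shift_ext K)
  shift_linearl shift_linearr shift_brxx shift_jacobi.

End ShiftExtension.

(** * Power series in one variable over a Lie algebra *)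

Definition cauchy_lie (F : fieldType) (K : lieAlgType F) : Type := nat -> K.

HB.instance Definition _ (F : fieldType) (K : lieAlgType F) :=
  GRing.Lmodule.copy (cauchy_lie K) (nat -> K).

Section CauchyBracket.
Variables (F : fieldType) (K : lieAlgType F).
Implicit Types (a b c : nat -> K) (n : nat).

(** The coefficient of [T^n] in the bracket of two power series: a convolution, without the binomial
    coefficients of [hurwitz]. *)
Fixpoint cauchy n a b : K :=
  if n is n'.+1 then lie (a 0%N) (b n) + cauchy n' (shift a) b
  else lie (a 0%N) (b 0%N).

Lemma cauchySr n a b :
  cauchy n.+1 a b = lie (a n.+1) (b 0%N) + cauchy n a (shift b).
Proof.
elim: n a => [|n IH] a; first by rewrite /= addrC.
by rewrite [LHS]/= -/(cauchy n.+1 (shift a) b) IH /= addrCA.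
Qed.

Lemma cauchy_linearl n c t a b :
  cauchy n (t *: a + b) c = t *: cauchy n a c + cauchy n b c.
Proof.
elim: n a b => [|n IH] a b /=; first by rewrite lie_linearl.
rewrite shift_linear IH -[(t *: a + b) 0%N]/(t *: a 0%N + b 0%N) lie_linearl.
by rewrite scalerDr addrACA.
Qed.

Lemma cauchyC n a b : cauchy n a b = - cauchy n b a.
Proof.
elim: n a b => [|n IH] a b; first by rewrite /= lieC.
by rewrite cauchySr /= IH lieC -opprD.
Qed.

Lemma cauchy_linearr n c t a b :
  cauchy n c (t *: a + b) = t *: cauchy n c a + cauchy n c b.
Proof. by rewrite ![cauchy n c _]cauchyC cauchy_linearl scalerN opprD. Qed.

Lemma cauchyxx n a : cauchy n a a = 0.
Proof.
suff: cauchy n a a = 0 /\ cauchy n.+1 a a = 0 by case.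
elim: n a => [|n IH] a; first by rewrite /= /shift liexx lieC addNr.
split; first by case: (IH a).
rewrite [LHS]/= -/(cauchy n.+1 (shift a) a) cauchySr (IH _).1 addr0.
by rewrite [X in X + _]lieC /shift addNr.
Qed.

Lemma cauchy_derl n u a b : lie u (cauchy n a b) =
  cauchy n (fun m => lie u (a m)) b + cauchy n a (fun m => lie u (b m)).
Proof.
elim: n a => [|n IH] a /=; first exact: lie_derl.
by rewrite lieDr IH lie_derl addrACA.
Qed.

Lemma cauchy0l n b : cauchy n 0 b = 0.
Proof.
elim: n => [|n IH] /=; first by rewrite lie0l.
by rewrite lie0l add0r -[shift 0]/(0 : nat -> K).
Qed.

Lemma cauchy_delta n p q (u v : K) :
  cauchy n (fun m => if m == p then u else 0) (fun m => if m == q then v else 0)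
  = if n == (p + q)%N then lie u v else 0.
Proof.
elim: p n => [|p IH] [|n] /=.
- by case: eqP; rewrite ?lie0r.
- rewrite -[shift _]/(0 : nat -> K) cauchy0l addr0 add0n.
  by case: eqP; rewrite ?lie0r.
- by rewrite lie0l.
- by rewrite lie0l add0r -[shift _]/(fun m => if m == p then u else 0) IH.
Qed.

Local Arguments cauchy : simpl never.

Lemma cauchy_jacobi n a b c :
  cauchy n a (fun m => cauchy m b c) + cauchy n b (fun m => cauchy m c a) +
  cauchy n c (fun m => cauchy m a b) = 0.
Proof.
elim: n a b c => [|n IH] a b c; first exact: lie_jacobi.
(* [up] is multiplication by [T]. Splitting [a] into its constant term and [T] times [shift a]
   reduces the identity to [cauchy_derl] for the constant term and to the induction hypothesis for
   [shift a]. *)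
pose up (s : nat -> K) m := if m is m'.+1 then s m' else 0.
have cauchy_up m s t : cauchy m.+1 s (up t) = cauchy m s t.
  by rewrite cauchySr lie0r add0r.
have -> : (fun m => cauchy m c a) =
    -1 *: (fun m => lie (a 0%N) (c m)) + up (fun m => cauchy m c (shift a)).
  apply/funext => -[|m]; rewrite [RHS]addrC -[RHS]/(_ + -1 *: _) scaleN1r.
    by rewrite add0r -lieC.
  by rewrite cauchySr addrC -lieC.
have -> : (fun m => cauchy m a b) =
    1 *: (fun m => lie (a 0%N) (b m)) + up (fun m => cauchy m (shift a) b).
  by apply/funext => -[|m]; rewrite [RHS]addrC -[RHS]/(_ + 1 *: _) scale1r
    ?add0r// addrC.
rewrite !cauchy_linearr !cauchy_up scale1r scaleN1r.
rewrite -[cauchy n.+1 a _]/(lie (a 0%N) (cauchy n.+1 b c) +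
  cauchy n (shift a) (fun m => cauchy m b c)).
rewrite cauchy_derl [cauchy n.+1 c _]cauchyC.
rewrite (AC ((((1*1)*1)*2)*2) ((1*6)*(2*4)*(3*5*7))) /= IH addr0.
set x := cauchy _ _ _; set y := cauchy _ _ _.
by rewrite addrN add0r addrN.
Qed.

End CauchyBracket.

Section CauchyLie.
Variables (F : fieldType) (K : lieAlgType F).
Let E := cauchy_lie K.

Definition cauchy_br (u v : E) : E := fun n => cauchy n u v.

Fact cauchy_br_linearl (w : E) (a : F) (u v : E) :
  cauchy_br (a *: u + v) w = a *: cauchy_br u w + cauchy_br v w.
Proof. by apply/funext => n; exact: cauchy_linearl. Qed.

Fact cauchy_br_linearr (w : E) (a : F) (u v : E) :
  cauchy_br w (a *: u + v) = a *: cauchy_br w u + cauchy_br w v.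
Proof. by apply/funext => n; exact: cauchy_linearr. Qed.

Fact cauchy_brxx (u : E) : cauchy_br u u = 0.
Proof. by apply/funext => n; exact: cauchyxx. Qed.

Fact cauchy_br_jacobi (u v w : E) :
  cauchy_br u (cauchy_br v w) + cauchy_br v (cauchy_br w u) +
  cauchy_br w (cauchy_br u v) = 0.
Proof. by apply/funext => n; exact: cauchy_jacobi. Qed.

HB.instance Definition _ := isLieAlgebra.Build F (cauchy_lie K)
  cauchy_br_linearl cauchy_br_linearr cauchy_brxx cauchy_br_jacobi.

End CauchyLie.

(* The proof of [lie_subalg M] is an argument so that the instances below can
   be inferred. *)
Definition subalg_pred (F : fieldType) (L : lieAlgType F) (M : set L)
  of lie_subalg M : {pred L} := fun u => `[< M u >].

Section Subalgebra.
Variables (F : fieldType) (L : lieAlgType F) (M : set L) (sM : lie_subalg M).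

Fact subalg_pred_submod : submod_closed (subalg_pred sM).
Proof.
split=> [|a u v]; rewrite !unfold_in.
  by apply/asboolP; exact: (lin_subspace0 sM.1).
move=> /asboolP Mu /asboolP Mv; apply/asboolP.
exact: (lin_subspaceD sM.1 (lin_subspaceZ a sM.1 Mu) Mv).
Qed.

HB.instance Definition _ :=
  GRing.isSubmodClosed.Build F L (subalg_pred sM) subalg_pred_submod.

Record subalg_type := SubalgElt
  { subalg_val :> L; subalg_valP : subalg_val \in subalg_pred sM }.

HB.instance Definition _ := [isSub for subalg_val].
HB.instance Definition _ := [Choice of subalg_type by <:].
HB.instance Definition _ := [SubChoice_isSubLmodule of subalg_type by <:].

Fact subalg_br_in (u v : subalg_type) :
  lie (subalg_val u) (subalg_val v) \in subalg_pred sM.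
Proof.
have /asboolP Mu := subalg_valP u; have /asboolP Mv := subalg_valP v.
by rewrite unfold_in; apply/asboolP; exact: sM.2.
Qed.

Definition subalg_br (u v : subalg_type) : subalg_type :=
  SubalgElt (subalg_br_in u v).

Fact subalg_linearl (w : subalg_type) (a : F) (u v : subalg_type) :
  subalg_br (a *: u + v) w = a *: subalg_br u w + subalg_br v w.
Proof. by apply: val_inj; exact: lie_linearl. Qed.

Fact subalg_linearr (w : subalg_type) (a : F) (u v : subalg_type) :
  subalg_br w (a *: u + v) = a *: subalg_br w u + subalg_br w v.
Proof. by apply: val_inj; exact: lie_linearr. Qed.

Fact subalg_brxx (u : subalg_type) : subalg_br u u = 0.
Proof. by apply: val_inj; exact: liexx. Qed.

Fact subalg_jacobi (u v w : subalg_type) :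
  subalg_br u (subalg_br v w) + subalg_br v (subalg_br w u) +
  subalg_br w (subalg_br u v) = 0.
Proof. by apply: val_inj; exact: lie_jacobi. Qed.

HB.instance Definition _ := isLieAlgebra.Build F subalg_type
  subalg_linearl subalg_linearr subalg_brxx subalg_jacobi.

End Subalgebra.

(** Map [L] to the subalgebra generated by the family, by freeness. Followed by the inclusion this
    fixes the family, so it is the identity by uniqueness. *)
Lemma free_on_generates (F : fieldType) (L : lieAlgType F) (I : Type)
    (e : I -> L) :
  free_on [set: L] [set: I] e -> lie_gen (range e) = [set: L].
Proof.
move=> [_ _ fr]; apply/seteqP; split=> // u _.
have sM := lie_gen_subalg (range e).
have eP i : e i \in subalg_pred sM.
  by rewrite unfold_in; apply/asboolP; apply: lie_gen_sub; exists i.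
have [f [[fZ fl] fe _]] := fr (subalg_type sM) (fun i => SubalgElt (eP i)).
have [h [_ _ uniqh]] := fr L e.
have -> : u = h u by apply: (uniqh id).
rewrite -(uniqh (fun u => subalg_val (f u))) //.
- by have := subalg_valP (f u); rewrite unfold_in => /asboolP.
- by split=> [a v w _ _|v w _ _]; rewrite ?fZ// fl.
- by move=> i _; rewrite fe.
Qed.

(** * Free sets and Lazard elimination *)

Section FreeSets.
Variables (F : fieldType) (L : lieAlgType F).
Implicit Types (G : set L) (c r u : L).

(** The homomorphism to the one-dimensional abelian algebra with value 1 at [r] and 0 at the other
    generators: the coefficient of [r] modulo brackets. *)
Lemma lie_free_coord G r : lie_free G -> G r ->
  exists f : L -> F, [/\ forall a u v, lie_gen G u -> lie_gen G v ->
      f (a *: u + v) = a * f u + f v,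
    f r = 1,
    forall u, lie_gen (G `\ r) u -> f u = 0
  & forall u v, lie_gen G u -> lie_gen G v -> f (lie u v) = 0].
Proof.
move=> freeG Gr.
have [f [[fZ fl] fG]] := freeG (abelian_lie F) (fun u => if u == r then 1 else 0 : F).
exists f; split=> //; first by rewrite fG// eqxx.
have GrG : G `\ r `<=` G by exact: subDsetl.
apply: lie_gen_ind.
- exact: (@lie_hom0 _ _ (abelian_lie F) _ f (lie_gen_subalg G) (conj fZ fl)).
- by move=> u [Gu ur]; rewrite fG//; case: eqP.
- move=> a u v /(lie_genS GrG) Gu /(lie_genS GrG) Gv fu fv.
  by rewrite fZ// fu fv scaler0 addr0.
- by move=> u v /(lie_genS GrG) Gu /(lie_genS GrG) Gv _ _; exact: fl.
Qed.

Lemma lie_free_notin G r : lie_free G -> G r -> ~ lie_gen (G `\ r) r.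
Proof.
move=> freeG Gr Gr'; have [f [_ fr f0 _]] := lie_free_coord freeG Gr.
by have := oner_neq0 F; rewrite -fr f0// eqxx.
Qed.

Lemma lie_free_neq0 G r : lie_free G -> G r -> r != 0.
Proof.
move=> freeG Gr; apply/eqP => r0; apply: (lie_free_notin freeG Gr).
by rewrite r0; exact: (lin_subspace0 (lie_gen_subspace _)).
Qed.

Lemma lie_free_exchange G r a b : lie_free G -> G r -> a != 0 ->
  lie_gen (G `\ r) (b - a *: r) ->
  [/\ lie_free (b |` (G `\ r)), lie_gen (b |` (G `\ r)) = lie_gen G
    & ~ lie_gen (G `\ r) b].
Proof.
move=> freeG Gr a0 Gb.
set G0 := G `\ r in Gb *; set G1 := b |` G0; set u := b - a *: r in Gb *.
have sG := lie_gen_subspace G; have sG1 := lie_gen_subspace G1.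
have G0G : G0 `<=` G by exact: subDsetl.
have G0G1 : G0 `<=` G1 by move=> v; right.
have bE : b = a *: r + u by rewrite /u addrC subrK.
have GG1 : lie_gen G1 = lie_gen G.
  apply/seteqP; split; apply: lie_gen_mono => v.
    case=> [->|/G0G]; last exact: lie_gen_sub.
    rewrite bE; apply: (lin_subspaceD sG); last exact: (lie_genS G0G).
    by apply: (lin_subspaceZ _ sG); exact: lie_gen_sub.
  move=> Gv; have [->|/eqP vr] := eqVneq v r; last first.
    by apply: lie_gen_sub; right; split.
  have -> : r = a^-1 *: (b - u) by rewrite /u subKr scalerK.
  apply: (lin_subspaceZ _ sG1); apply: (lin_subspaceB sG1).
    by apply: lie_gen_sub; left.
  exact: (lie_genS G0G1).
split=> //; last first.
  move=> G0b; apply: (lie_free_notin freeG Gr).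
  suff: lie_gen G0 (a^-1 *: (b - u)) by rewrite /u subKr scalerK.
  have sG0 := lie_gen_subspace G0.
  by apply: (lin_subspaceZ _ sG0); exact: (lin_subspaceB sG0).
move=> K y; rewrite GG1.
(* For [f b = y b] the value of [f] at [r] has to compensate for [u]. The image of [u] depends on
   the other generators only, so the auxiliary extension [f1] supplies it in advance. *)
have [f1 [hf1 f1G]] := freeG K y.
have [f [hf fG]] := freeG K (fun v => if v == r then a^-1 *: (y b - f1 u) else y v).
have fG0 v : G0 v -> f v = y v.
  by move=> [Gv vr]; rewrite fG//; case: eqP.
exists f; split=> // v [->|]; last exact: fG0.
rewrite {1}bE hf.1//; last 2 first.
- exact: lie_gen_sub.
- exact: (lie_genS G0G).
rewrite fG// eqxx scalerA divff// scale1r.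
suff -> : f u = f1 u by rewrite subrK.
apply: (@lie_hom_eq _ _ K G0) Gb.
- exact: lie_homS (lie_genS G0G) hf.
- exact: lie_homS (lie_genS G0G) hf1.
- by move=> w G0w; rewrite fG0// f1G//; exact: G0G.
Qed.

End FreeSets.

Section LazardElimination.
Variables (F : fieldType) (L : lieAlgType F) (G : set L) (c : L).
Hypotheses (freeG : lie_free G) (Gc : G c).

(** Generators of the kernel of the projection of [lie_gen G] to the line of [c] that kills the
    other generators; these themselves are the case [k = 0]. *)
Definition lazard : set L :=
  [set u | exists k z, [/\ G z, z <> c & u = iter k (lie c) z]].

Lemma lazard_iter k z : G z -> z <> c -> lazard (iter k (lie c) z).
Proof. by move=> Gz zc; exists k, z. Qed.

Lemma lazard_sub_gen : lazard `<=` lie_gen G.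
Proof.
move=> _ [k [z [Gz _ ->]]]; elim: k => [|k IH]; first exact: lie_gen_sub.
by rewrite iterS; apply: lie_gen_lie => //; exact: lie_gen_sub.
Qed.

Lemma lazard_gen_sub : lie_gen lazard `<=` lie_gen G.
Proof. exact: lie_gen_mono lazard_sub_gen. Qed.

Lemma lazard_gen_ad u : lie_gen lazard u -> lie_gen lazard (lie c u).
Proof.
have sl := lie_gen_subspace lazard.
apply: (@lie_gen_ind _ _ lazard (fun u => lie_gen lazard (lie c u))).
- by rewrite lie0r; exact: (lin_subspace0 sl).
- move=> _ [k [z [Gz zc ->]]]; rewrite -iterS.
  by apply: lie_gen_sub; exact: lazard_iter.
- by move=> a v w _ _ lv lw; rewrite lie_linearr;
    apply: (lin_subspaceD sl) => //; exact: (lin_subspaceZ a sl).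
- by move=> v w Gv Gw lv lw; rewrite lie_derl; apply: (lin_subspaceD sl);
    exact: lie_gen_lie.
Qed.

Lemma lazard_decomp u : lie_gen G u -> exists a, lie_gen lazard (u - a *: c).
Proof.
have sl := lie_gen_subspace lazard.
apply: (@lie_gen_ind _ _ G (fun u => exists a, lie_gen lazard (u - a *: c))).
- by exists 0; rewrite scale0r subr0; exact: (lin_subspace0 sl).
- move=> v Gv; have [->|/eqP vc] := eqVneq v c.
    by exists 1; rewrite scale1r subrr; exact: (lin_subspace0 sl).
  exists 0; rewrite scale0r subr0; apply: lie_gen_sub.
  exact: (@lazard_iter 0).
- move=> t v w _ _ [a lv] [b lw]; exists (t * a + b).
  rewrite scalerDl -scalerA opprD addrACA -scalerBr.
  by apply: (lin_subspaceD sl) => //; exact: (lin_subspaceZ t sl).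
- move=> v w _ _ [a lv] [b lw]; exists 0; rewrite scale0r subr0.
  rewrite -[v](subrK (a *: c)) -[w](subrK (b *: c)).
  move: (v - _) (w - _) lv lw => p q lp lq.
  have -> : lie (p + a *: c) (q + b *: c) =
      lie p q + (a *: lie c q - b *: lie c p).
    rewrite lieDl !lieDr !lieZl !lieZr liexx !scaler0 addr0 -addrA.
    by rewrite [lie p c]lieC scalerN [- _ + _]addrC.
  apply: (lin_subspaceD sl); first exact: lie_gen_lie.
  by apply: (lin_subspaceB sl); apply: (lin_subspaceZ _ sl); exact: lazard_gen_ad.
Qed.

(* Send [c] to the derivation [shift] and [z <> c] to the sequence [y z]; the
   elimination generators then act by shifting, and taking the term of index 0
   is a homomorphism on the kernel of the projection to the line of [shift]. *)
Lemma lazard_universal (K : lieAlgType F) (y : L -> nat -> K) :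
  exists f : L -> K, lie_hom_on (lie_gen lazard) f /\
    forall k z, G z -> z <> c -> f (iter k (lie c) z) = y z k.
Proof.
pose Y (z : L) : shift_ext K := if z == c then (1, 0) else (0, y z).
have [f [hf fG]] := freeG Y.
have fc : f c = (1, 0) by rewrite fG// /Y eqxx.
have f0 := lie_hom0 (lie_gen_subalg G) hf.
have fz z k : G z -> z <> c -> f (iter k (lie c) z) = (0, fun n => y z (n + k)%N).
  move=> Gz zc; elim: k => [|k IH].
    rewrite /= fG// /Y; case: eqP => // _; congr pair.
    by apply/funext => n; rewrite addn0.
  rewrite iterS hf.2; last 2 first.
  - exact: lie_gen_sub.
  - by apply: lazard_sub_gen; exact: lazard_iter.
  rewrite IH fc; apply: shift_ext_eq => // n.
  rewrite -[LHS]/(1 *: y z (n.+1 + k)%N - 0 *: (0 : K) +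
    hurwitz n (0 : nat -> K) (fun n => y z (n + k)%N)).
  by rewrite scale1r scale0r subr0 hurwitz0l addr0 addSnnS.
have fl0 u : lie_gen lazard u -> (f u).1 = 0.
  apply: (@lie_gen_ind _ _ lazard (fun u => (f u).1 = 0)).
  - by rewrite f0.
  - by move=> _ [k [z [Gz zc ->]]]; rewrite fz.
  - move=> a v w /lazard_gen_sub Gv /lazard_gen_sub Gw fv fw.
    by rewrite hf.1// -[LHS]/(a * (f v).1 + (f w).1) fv fw mulr0 addr0.
  - by move=> v w /lazard_gen_sub Gv /lazard_gen_sub Gw _ _; rewrite hf.2.
exists (fun u => (f u).2 0%N); split; last by move=> k z Gz zc; rewrite fz.
split=> [a v w|v w] lv lw.
  by rewrite hf.1//; exact: lazard_gen_sub.
rewrite hf.2; [|exact: lazard_gen_sub..].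
by rewrite shift_brE !fl0// !scale0r subr0 add0r.
Qed.

Lemma lazard_free : lie_free lazard.
Proof.
move=> K y; have [f [hf fG]] := lazard_universal (fun z k => y (iter k (lie c) z)).
by exists f; split=> // _ [k [z [Gz zc ->]]]; exact: fG.
Qed.

(** The coordinate of [c] vanishes on all elimination generators: for [k = 0] they are other free
    generators, for [k > 0] they are brackets. *)
Lemma lazard_notin : ~ lie_gen lazard c.
Proof.
have [f [fZ fc f0 fl]] := lie_free_coord freeG Gc.
have sl := lie_gen_subalg lazard.
move=> lc; have := oner_neq0 F; rewrite -fc => /eqP; apply.
apply: (@lie_gen_ind _ _ lazard (fun u => f u = 0)) lc.
- by apply: f0; exact: (lin_subspace0 (lie_gen_subspace _)).
- move=> _ [[|k] [z [Gz zc ->]]]; first by apply: f0; exact: lie_gen_sub.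
  rewrite iterS fl//; first exact: lie_gen_sub.
  by apply: lazard_sub_gen; exact: lazard_iter.
- move=> a v w /lazard_gen_sub Gv /lazard_gen_sub Gw fv fw.
  by rewrite fZ// fv fw mulr0 addr0.
- by move=> v w /lazard_gen_sub Gv /lazard_gen_sub Gw _ _; exact: fl.
Qed.

(** The homomorphism with the indicator of [(z, k)] as prescribed values separates the first iterate
    from all others. This makes the later count of generators exact. *)
Lemma lazard_inj k k' z z' : G z -> z <> c -> G z' -> z' <> c ->
  iter k (lie c) z = iter k' (lie c) z' -> z = z' /\ k = k'.
Proof.
move=> Gz zc Gz' zc' e.
have [f [_ fG]] := lazard_universal (K := abelian_lie F)
  (fun v n => if (v == z) && (n == k) then 1 else 0 : F).
have := fG k z Gz zc; rewrite e fG// !eqxx /=.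
by case: eqP => [->|_] /=; [case: eqP => [->//|_]|] => /eqP;
  rewrite eq_sym (oner_eq0 F).
Qed.

Lemma lazard_quot_basis :
  quot_basis (lie_gen G) (lie_gen lazard) (fun _ : 'I_1 => c).
Proof.
split=> [_|u Gu|a]; first exact: lie_gen_sub.
  by have [a la] := lazard_decomp Gu; exists (fun=> a); rewrite big_ord1.
rewrite big_ord1 => la i; rewrite ord1; apply/eqP/negPn/negP => a0.
apply: lazard_notin; rewrite -[c](scalerK a0).
exact: (lin_subspaceZ _ (lie_gen_subspace _)).
Qed.

End LazardElimination.

(** * The grading of a free Lie algebra *)

Lemma wt_gt0 d (t : liecomm d) : (0 < wt t)%N.
Proof. by elim: t => //= u IHu v _; rewrite ltn_addr. Qed.

Lemma wt_Br d (s t : liecomm d) : wt (Br s t) = (wt s + wt t)%N.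
Proof. by []. Qed.

Section HomogeneousParts.
Variables (F : fieldType) (L : lieAlgType F) (d : nat) (x : 'I_d -> L).
Local Notation "''L_' n" := (lie_homog x n) (at level 8, n at level 2).

Lemma homog_subspace n : lin_subspace 'L_n.
Proof. exact: lin_span_subspace. Qed.

Lemma homog_eval t : 'L_(wt t) (lie_eval x t).
Proof. by apply: lin_span_sub; exists t. Qed.

Lemma homog_lie m n u v : 'L_m u -> 'L_n v -> 'L_(m + n) (lie u v).
Proof.
move=> Lu; move: v; apply: lin_span_min.
  apply/lin_subspaceP; split=> [|a v w Lv Lw].
    by rewrite lie0r; exact: lin_subspace0 (homog_subspace _).
  rewrite lie_linearr; apply: (lin_subspaceD (homog_subspace _)) => //.
  exact: (lin_subspaceZ a (homog_subspace _)).
move=> _ [t <- <-]; move: u Lu; apply: lin_span_min.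
  apply/lin_subspaceP; split=> [|a v w Lv Lw].
    by rewrite lie0l; exact: lin_subspace0 (homog_subspace _).
  rewrite lie_linearl; apply: (lin_subspaceD (homog_subspace _)) => //.
  exact: (lin_subspaceZ a (homog_subspace _)).
by move=> _ [s <- <-]; rewrite -wt_Br; exact: (@homog_eval (Br s t)).
Qed.

Lemma lie_ge_subspace n : lin_subspace (lie_ge x n).
Proof. exact: lin_span_subspace. Qed.

Lemma lie_ge_homog n m u : (n <= m)%N -> 'L_m u -> lie_ge x n u.
Proof. by move=> nm Lu; apply: lin_span_sub; exists m. Qed.

Record grading (pi : nat -> L -> L) : Prop := Grading {
  gr_linear : forall n a u v, pi n (a *: u + v) = a *: pi n u + pi n v;
  gr_id : forall n u, 'L_n u -> pi n u = u;
  gr_ne : forall m n u, 'L_n u -> m != n -> pi m u = 0;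
  gr_homog : forall n u, 'L_n (pi n u);
  gr_pi0 : forall u, pi 0%N u = 0;
  gr_lie : forall n u v, pi n (lie u v) = cauchy n (pi^~ u) (pi^~ v);
  gr_sum : forall u, exists N, u = \sum_(m < N) pi m u }.

Lemma span_eval : lie_gen (range x) = [set: L] ->
  lin_span (range (lie_eval x)) = [set: L].
Proof.
move=> genx; apply/seteqP; split=> // u _.
have: lie_gen (range x) u by rewrite genx.
have sW := lin_span_subspace (range (lie_eval x)).
apply: lie_gen_min; last first.
  by move=> _ [i _ <-]; apply: lin_span_sub; exists (Gen i).
split=> // v w Wv; move: w; apply: lin_span_min.
  apply/lin_subspaceP; split=> [|a w1 w2 Ww1 Ww2].
    by rewrite lie0r; exact: lin_subspace0.
  rewrite lie_linearr; apply: (lin_subspaceD sW) => //.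
  exact: (lin_subspaceZ a sW).
move=> _ [t _ <-]; move: v Wv; apply: lin_span_min.
  apply/lin_subspaceP; split=> [|a w1 w2 Ww1 Ww2].
    by rewrite lie0l; exact: lin_subspace0.
  rewrite lie_linearl; apply: (lin_subspaceD sW) => //.
  exact: (lin_subspaceZ a sW).
by move=> _ [s _ <-]; apply: lin_span_sub; exists (Br s t).
Qed.

Hypothesis freeL : free_on [set: L] [set: 'I_d] x.

(* The homogeneous parts of [u] are the coefficients of the image of [u] under
   the homomorphism to power series in one variable T with x i |-> x i T. *)
Lemma grading_exists : exists pi, grading pi.
Proof.
have [_ _ fr] := freeL.
have [f [[fZ fl] fx _]] :=
  fr (cauchy_lie L) (fun i n => if n == 1%N then x i else 0).
have fE t n : f (lie_eval x t) n = if n == wt t then lie_eval x t else 0.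
  elim: t n => [i|s IHs t IHt] n /=; first by rewrite fx.
  rewrite fl// -[LHS]/(cauchy n (f (lie_eval x s)) (f (lie_eval x t))).
  have -> : f (lie_eval x s) =
      fun n => if n == wt s then lie_eval x s else 0 by exact/funext/IHs.
  have -> : f (lie_eval x t) =
      fun n => if n == wt t then lie_eval x t else 0 by exact/funext/IHt.
  exact: cauchy_delta.
have f0 n : f 0 n = 0.
  by have := fZ (-1) 0 0 I I; rewrite scaler0 addr0 scaleN1r addNr => ->.
have fZn n a u v : f (a *: u + v) n = a *: f u n + f v n by rewrite fZ.
have W u (P : L -> Prop) : P 0 ->
    (forall a u v, P u -> P v -> P (a *: u + v)) ->
    (forall t, P (lie_eval x t)) -> P u.
  move=> P0 PZ Pt; have : lin_span (range (lie_eval x)) u.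
    by rewrite span_eval//; exact: free_on_generates.
  apply: (lin_span_min (A := P)); first exact/lin_subspaceP.
  by move=> _ [t _ <-].
have Lf m n u : 'L_n u -> f u m = if m == n then u else 0.
  apply: (lin_span_min (A := [set u | f u m = if m == n then u else 0])).
    apply/lin_subspaceP; split=> /= [|a v w fv fw]; first by rewrite f0 if_same.
    by rewrite fZn fv fw; case: eqP => //; rewrite scaler0 addr0.
  by move=> _ [t <- <-] /=; rewrite fE.
exists (fun n u => f u n); split=> //.
- by move=> n u /Lf ->; rewrite eqxx.
- by move=> m n u /Lf -> /negPf ->.
- move=> n u; apply: (W u (fun u => 'L_n (f u n))).
  + by rewrite f0; exact: (lin_subspace0 (homog_subspace _)).
  + move=> a v w Lv Lw; rewrite fZn.
    apply: (lin_subspaceD (homog_subspace _)) => //.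
    exact: (lin_subspaceZ a (homog_subspace _)).
  + move=> t; rewrite fE; case: eqP => [->|_]; first exact: homog_eval.
    exact: (lin_subspace0 (homog_subspace _)).
- move=> u; apply: (W u (fun u => f u 0%N = 0)) => //.
  + by move=> a v w fv fw; rewrite fZn fv fw scaler0 addr0.
  + by move=> t; rewrite fE; have := wt_gt0 t; case: (wt t).
- by move=> n u v; rewrite fl.
move=> u.
suff [N /(_ N (leqnn N)) uE] :
    exists N, forall M, (N <= M)%N -> u = \sum_(m < M) f u m by exists N.
apply: (W u (fun u => exists N, forall M, (N <= M)%N -> u = \sum_(m < M) f u m)).
- by exists 0%N => M _; rewrite big1// => i _; rewrite f0.
- move=> a v w [N1 h1] [N2 h2]; exists (maxn N1 N2) => M.
  rewrite geq_max => /andP[/h1 vE /h2 wE]; rewrite {1}vE {1}wE.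
  by rewrite scaler_sumr -big_split; apply: eq_bigr => i _; rewrite fZn.
- move=> t; exists (wt t).+1 => M tM; rewrite (bigD1 (Ordinal tM))//= fE eqxx.
  rewrite big1 ?addr0// => i; rewrite -val_eqE /= => it.
  by rewrite fE (negPf it).
Qed.

End HomogeneousParts.

Section Grading.
Variables (F : fieldType) (L : lieAlgType F) (d : nat) (x : 'I_d -> L).
Local Notation "''L_' n" := (lie_homog x n) (at level 8, n at level 2).
Variables (pi : nat -> L -> L) (gr : grading x pi).

Lemma gr0 n : pi n 0 = 0.
Proof.
by have := gr_linear gr n (-1) 0 0; rewrite scaler0 addr0 scaleN1r addNr.
Qed.

Lemma grN n u : pi n (- u) = - pi n u.
Proof. by rewrite -scaleN1r -[_ *: u]addr0 (gr_linear gr) gr0 addr0 scaleN1r. Qed.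

Lemma grB n u v : pi n (u - v) = pi n u - pi n v.
Proof. by rewrite -[u]scale1r (gr_linear gr) grN !scale1r. Qed.

Lemma grZ n a u : pi n (a *: u) = a *: pi n u.
Proof. by rewrite -[_ *: u]addr0 (gr_linear gr) gr0 addr0. Qed.

Lemma lie_geP n u : lie_ge x n u <-> forall m, (m < n)%N -> pi m u = 0.
Proof.
split=> [|u0].
  apply: (lin_span_min (A := [set u | forall m, (m < n)%N -> pi m u = 0])).
    apply/lin_subspaceP; split=> /= [m _|a v w v0 w0 m mn]; first exact: gr0.
    by rewrite (gr_linear gr) v0// w0// scaler0 addr0.
  move=> v [m /= nm Lv] k kn; apply: (gr_ne gr Lv).
  by rewrite neq_ltn (leq_trans kn nm).
have [N ->] := gr_sum gr u.
apply: lin_subspace_sum => [|i _]; first exact: lie_ge_subspace.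
have [/u0 ->|ni] := ltnP i n; first exact: (lin_subspace0 (lie_ge_subspace _ _)).
by apply: lie_ge_homog ni _; apply: (gr_homog gr).
Qed.

Lemma gr_lie_mem n (A B : nat -> set L) (C : set L) u v : lin_subspace C ->
  (forall m, (m <= n)%N -> A m (pi m u)) -> (forall m, (m <= n)%N -> B m (pi m v)) ->
  (forall i j a b, (i + j = n)%N -> A i a -> B j b -> C (lie a b)) ->
  C (pi n (lie u v)).
Proof.
move=> sC Au Bv ABC; rewrite (gr_lie gr).
(* The recursion of [cauchy] shifts its first argument, so the induction runs over partial sums
   starting at index [k]. *)
suff H m k : (k + m = n)%N -> C (cauchy m (fun i => pi (k + i)%N u) (pi^~ v)).
  exact: (H n 0%N).
elim: m k => [|m IH] k kn.
  by rewrite /= addn0; apply: (ABC k 0%N); rewrite -?kn ?addn0//; [apply: Au|apply: Bv];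
    rewrite -kn ?addn0.
rewrite /=; apply: (lin_subspaceD sC).
  by rewrite addn0; apply: (ABC k m.+1) => //; [apply: Au|apply: Bv];
    rewrite -kn ?leq_addr ?leq_addl.
rewrite (_ : shift _ = fun i => pi (k.+1 + i)%N u); last first.
  by apply/funext => i; rewrite /shift addSnnS.
by apply: IH; rewrite addSnnS.
Qed.

Lemma lie_ge_ideal n u v : lie_ge x n v -> lie_ge x n (lie u v).
Proof.
move=> /lie_geP Lv; apply/lie_geP => m mn.
apply: (@gr_lie_mem m (fun=> setT) (fun=> [set 0]) [set 0]) => //.
- by apply/lin_subspaceP; split=> //= a _ _ -> ->; rewrite scaler0 addr0.
- by move=> k km /=; apply: Lv; exact: leq_ltn_trans km mn.
- by move=> i j a b _ _ ->; rewrite lie0r.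
Qed.

Lemma lie_ge_subalg n : lie_subalg (lie_ge x n).
Proof. by split=> [|u v _]; [exact: lie_ge_subspace|exact: lie_ge_ideal]. Qed.

Lemma gr_gen (G : set L) n u : (forall v, G v -> exists m, 'L_m v) ->
  lie_gen G u -> lie_gen G (pi n u).
Proof.
move=> hG Gu; have sG := lie_gen_subspace G.
apply: (@lie_gen_ind _ _ G (fun u => forall n, lie_gen G (pi n u))) n.
- by move=> n; rewrite gr0; exact: lin_subspace0.
- move=> v Gv n; have [m Lv] := hG v Gv.
  have [->|nm] := eqVneq n m; first by rewrite (gr_id gr Lv); exact: lie_gen_sub.
  by rewrite (gr_ne gr Lv nm); exact: lin_subspace0.
- move=> a v w _ _ Gv Gw n; rewrite (gr_linear gr).
  by apply: (lin_subspaceD sG) => //; exact: (lin_subspaceZ a sG).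
- move=> v w _ _ Gv Gw n.
  by apply: (@gr_lie_mem n (fun=> lie_gen G) (fun=> lie_gen G)) => // i j a b _;
    exact: lie_gen_lie.
- by [].
Qed.

(* In weights at most [n] the generators of weight greater than [n] do not
   contribute, and those of weight [n] contribute linearly. *)
Lemma gr_gen_split (G : set L) r n : 'L_n r ->
  (forall v, G v -> exists m, 'L_m v) -> forall u, lie_gen G u -> 'L_n u ->
  exists a, lie_gen (G `\ r) (u - a *: r).
Proof.
move=> Lr hG u Gu Lu; rewrite -(gr_id gr Lu).
set G0 := G `\ r; have sG := lie_gen_subspace G0.
suff [] : (forall m, (m < n)%N -> lie_gen G0 (pi m u)) /\
  exists a, lie_gen G0 (pi n u - a *: r) by [].
apply: (@lie_gen_ind _ _ G (fun u =>
  (forall m, (m < n)%N -> lie_gen G0 (pi m u)) /\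
  exists a, lie_gen G0 (pi n u - a *: r))) Gu.
- split=> [m _|]; first by rewrite gr0; exact: lin_subspace0.
  by exists 0; rewrite gr0 scale0r subr0; exact: lin_subspace0.
- move=> v Gv; have [->|/eqP vr] := eqVneq v r.
    split=> [m mn|].
      by rewrite (gr_ne gr Lr) ?ltn_eqF//; exact: lin_subspace0.
    by exists 1; rewrite (gr_id gr Lr) scale1r subrr; exact: lin_subspace0.
  have Gpi m : lie_gen G0 (pi m v).
    apply: gr_gen; first by move=> w [Gw _]; exact: hG.
    by apply: lie_gen_sub; split.
  by split=> //; exists 0; rewrite scale0r subr0.
- move=> t v w _ _ [Gv [a Gva]] [Gw [b Gwb]]; split=> [m mn|].
    rewrite (gr_linear gr); apply: (lin_subspaceD sG); last exact: Gw.
    by apply: (lin_subspaceZ _ sG); exact: Gv.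
  exists (t * a + b); rewrite (gr_linear gr) scalerDl -scalerA opprD addrACA -scalerBr.
  by apply: (lin_subspaceD sG) => //; exact: (lin_subspaceZ t sG).
- move=> v w _ _ [Gv _] [Gw _].
  (* Components of weight 0 vanish, so up to weight [n] a bracket involves only components of weight
     less than [n] of its entries, and these are free of [r]. *)
  have H m : (m <= n)%N -> lie_gen G0 (pi m (lie v w)).
    move=> mn.
    apply: (@gr_lie_mem m
      (fun i => [set a | (i = 0%N -> a = 0) /\ ((i < n)%N -> lie_gen G0 a)])
      (fun i => [set a | (i = 0%N -> a = 0) /\ ((i < n)%N -> lie_gen G0 a)])) => //.
    + by move=> i _; split=> [->|/Gv//]; exact: (gr_pi0 gr).
    + by move=> i _; split=> [->|/Gw//]; exact: (gr_pi0 gr).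
    + move=> i j a b ij [a0 Ga] [b0 Gb].
      have [i0|i0] := posnP i; first by rewrite a0// lie0l; exact: lin_subspace0.
      have [j0|j0] := posnP j; first by rewrite b0// lie0r; exact: lin_subspace0.
      by apply: lie_gen_lie; [apply: Ga|apply: Gb]; lia.
  split=> [m /ltnW /H//|]; exists 0; rewrite scale0r subr0; exact: H.
Qed.

End Grading.

(** * Basic commutators *)

HB.instance Definition _ d := gen_eqMixin (liecomm d).
HB.instance Definition _ d := gen_choiceMixin (liecomm d).

(** Compare weights first and break ties by an arbitrary well-order of the formal commutators. *)
Lemma basic_order_exists d : exists le : rel (liecomm d), basic_order le.
Proof.
have [R Rwo] := well_ordering_principle (liecomm d).
have Rchain : wo_chain R predT by move=> A _; exact: Rwo.
have Ranti s t : R s t -> R t s -> s = t.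
  by move=> Rst Rts; apply: (wo_chain_antisymmetric Rchain); rewrite ?Rst.
pose le (s t : liecomm d) := (wt s < wt t)%N || ((wt s == wt t) && R s t).
exists le; split; last by move=> u v _ _ uv; rewrite /le; lia.
apply: antisymmetric_wo_chain => [s t _ _ /andP[]|A _ [t0 At0]].
  rewrite /le => /orP[st|/andP[/eqP st Rst]] /orP[ts|/andP[/eqP ts Rts]]; try lia.
  exact: Ranti.
have exn : exists n, `[< exists2 t, t \in A & wt t = n >].
  by exists (wt t0); apply/asboolP; exists t0.
case: (ex_minnP exn) => n /asboolP[t1 At1 t1n] minn.
have [|t [[/andP[At /eqP tn] tmin] _]] := Rwo [pred t | (t \in A) && (wt t == n)].
  by exists t1; rewrite inE At1 t1n eqxx.
exists t; split=> // s As; rewrite /le tn.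
have := minn (wt s); rewrite leq_eqVlt => /(_ _)/orP[|/eqP ns|->//].
  by apply/asboolP; exists s.
by rewrite -ns eqxx /= (tmin s) ?orbT// inE As -ns eqxx.
Qed.

Lemma span_lie_l (F : fieldType) (L : lieAlgType F) (G A : set L) (v : L) :
  lin_subspace A -> (forall u, G u -> A (lie u v)) ->
  forall u, lin_span G u -> A (lie u v).
Proof.
move=> sA GA; apply: lin_span_min => //; apply/lin_subspaceP.
split=> [|a u w Au Aw]; first by rewrite lie0l; exact: lin_subspace0.
by rewrite lie_linearl; apply: (lin_subspaceD sA) => //; exact: lin_subspaceZ.
Qed.

Section BasicCommutators.
Variables (d : nat) (le : rel (liecomm d)).
Hypothesis le_basic : basic_order le.
Implicit Types (s t u v w : liecomm d).
Local Notation B := (basic le).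
Local Notation "s '<b' t" := (~~ le t s) (at level 70).

Lemma basic_le_total u v : B u -> B v -> le u v || le v u.
Proof. by move=> Bu Bv; exact: (wo_chainW le_basic.1). Qed.

Lemma basic_le_anti u v : B u -> B v -> le u v -> le v u -> u = v.
Proof.
by move=> Bu Bv uv vu; apply: (wo_chain_antisymmetric le_basic.1) => //; rewrite uv.
Qed.

(** Transitivity is extracted from the well-ordering property, applied to the three-element set of
    [u], [v], [w]: whichever of them is least, the claim follows by antisymmetry. *)
Lemma basic_le_trans u v w : B u -> B v -> B w -> le u v -> le v w -> le u w.
Proof.
move=> Bu Bv Bw uv vw.
have sub : {subset [:: u; v; w] <= B}.
  by move=> z; rewrite !inE => /or3P[]/eqP ->.
have [|z [[zA zmin] _]] := le_basic.1 [mem [:: u; v; w]] sub.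
  by exists u; rewrite !inE eqxx.
have [zu zv zw] : [/\ le z u, le z v & le z w].
  by split; apply: zmin; rewrite !inE eqxx ?orbT.
move: zA; rewrite !inE => /or3P[]/eqP ?; subst z => //.
- by rewrite (basic_le_anti Bu Bv).
- by rewrite -(basic_le_anti Bv Bw).
Qed.

Lemma basic_lt_trans u v w : B u -> B v -> B w -> u <b v -> v <b w -> u <b w.
Proof.
move=> Bu Bv Bw uv vw; apply/negP => wu; move/negP: vw; apply.
apply: (basic_le_trans Bw Bu Bv wu).
by have := basic_le_total Bu Bv; rewrite (negPf uv) orbF.
Qed.

Fixpoint comms n : seq (liecomm d) :=
  if n is n'.+1 then
    [seq Gen i | i <- enum 'I_d] ++
    [seq Br s t | s <- comms n', t <- comms n']
  else [::].

Lemma mem_comms n t : (wt t <= n)%N -> t \in comms n.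
Proof.
elim: n t => [|n IH] t; first by have := wt_gt0 t; lia.
case: t => [i _|s t]; rewrite /= mem_cat.
  by rewrite map_f// mem_enum.
move=> wst; apply/orP; right; apply: allpairs_f; apply: IH.
  by have := wt_gt0 t; lia.
by have := wt_gt0 s; lia.
Qed.

(** The termination measure of the rewriting below: the list is finite and contains every commutator
    of weight at most [n], so the count drops when [v] grows. *)
Definition above n v := count [pred w | B w && (v <b w)] (comms n).

Lemma above_lt n u v : B u -> B v -> (wt u <= n)%N -> v <b u ->
  (above n u < above n v)%N.
Proof.
move=> Bu Bv un vu; pose P w := B w && (u <b w).
have dis : count (predI P (pred1 u)) (comms n) = 0%N.
  apply/eqP; rewrite -leqn0 leqNgt -has_count; apply/hasPn => w _ /=.
  apply/negP => /andP[/andP[Bw uw] /eqP wu].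
  by move/negP: uw; apply; rewrite wu (wo_chain_reflexive le_basic.1).
have uin : (0 < count (pred1 u) (comms n))%N.
  by rewrite -has_count has_pred1 mem_comms.
apply: (@leq_trans (count (predU P (pred1 u)) (comms n))).
  have := count_predUI P (pred1 u) (comms n); rewrite dis addn0 => ->.
  by rewrite -addn1 leq_add2l.
apply: sub_count => w /= /orP[/andP[Bw uw]|/eqP ->]; last by rewrite Bu vu.
by rewrite Bw (basic_lt_trans Bv Bu Bw).
Qed.

Variables (F : fieldType) (L : lieAlgType F) (x : 'I_d -> L).
Local Notation "''L_' n" := (lie_homog x n) (at level 8, n at level 2).
Local Notation ev := (lie_eval x).

Definition basic_span n : set L :=
  lin_span [set ev t | t in [set t | B t /\ wt t = n]].

Lemma basic_span_subspace n : lin_subspace (basic_span n).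
Proof. exact: lin_span_subspace. Qed.

Lemma basic_span_eval t : B t -> basic_span (wt t) (ev t).
Proof. by move=> Bt; apply: lin_span_sub; exists t. Qed.

(* Rewriting [[y, z], v] = [[y, v], z] + [y, [z, v]] when v < z < y increases the
   smaller entry, of which only finitely many values are possible. *)
Lemma basic_span_lie n :
  (forall m t, (m < n)%N -> wt t = m -> basic_span m (ev t)) ->
  forall s t, B s -> B t -> (wt s + wt t = n)%N -> basic_span n (lie (ev s) (ev t)).
Proof.
move=> IHn s t Bs Bt stn.
have sW := basic_span_subspace n.
have [K sK tK] : exists2 K, (above n s < K)%N & (above n t < K)%N.
  by exists (above n s + above n t).+1; rewrite ltnS ?leq_addr ?leq_addl.
elim: K s t Bs Bt stn sK tK => // K IH s t Bs Bt stn sK tK.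
wlog ts : s t Bs Bt stn sK tK / t <b s.
  move=> H; have [st|] := boolP (le s t); last exact: H.
  have [ts|nts] := boolP (le t s); last first.
    rewrite lieC; apply: (lin_subspaceN sW); apply: H => //.
    by rewrite addnC.
  by rewrite (basic_le_anti Bs Bt st ts) liexx; exact: lin_subspace0.
have IHgt a b : B a -> B b -> (wt a + wt b = n)%N -> t <b a -> t <b b ->
    basic_span n (lie (ev a) (ev b)).
  move=> Ba Bb abn ta tb; have wa := wt_gt0 a; have wb := wt_gt0 b.
  by apply: IH => //; (apply: leq_trans (above_lt (v := t) _ _ _ _) _ => //; lia).
case: s Bs stn sK ts IHgt => [i|y z] Bs stn sK ts IHgt.
  by rewrite -stn; apply: (@basic_span_eval (Br (Gen i) t)); rewrite /= Bt ts.
have [zt|nzt] := boolP (le z t).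
  by rewrite -stn; apply: (@basic_span_eval (Br (Br y z) t)); rewrite /= -/(B (Br y z)) Bs Bt ts zt.
have [By Bz zy] : [/\ B y, B z & z <b y] by move: Bs => /= /and4P[].
have ty : t <b y by exact: basic_lt_trans zy.
have wtE : wt (Br y z) = (wt y + wt z)%N by [].
have [wy wz wt0] : [/\ (0 < wt y)%N, (0 < wt z)%N & (0 < wt t)%N].
  by rewrite !wt_gt0.
(* Here [t] lies below [z] and [y]. The brackets [[t, y]] and [[t, z]] expand into basic commutators
   of weight greater than [wt t], hence also beyond [t], so [IHgt] applies to both summands. *)
rewrite lieC lie_derl; apply: (lin_subspaceN sW); apply: (lin_subspaceD sW).
  apply: (span_lie_l sW) (IHn (wt t + wt y)%N (Br t y) _ _) => //; last by lia.
  move=> _ [b [Bb wb] <-]; apply: IHgt => //; first by lia.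
  by apply: le_basic.2 => //; lia.
rewrite lieC; apply: (lin_subspaceN sW).
apply: (span_lie_l sW) (IHn (wt t + wt z)%N (Br t z) _ _) => //; last by lia.
move=> _ [b [Bb wb] <-]; apply: IHgt => //; first by lia.
by apply: le_basic.2 => //; lia.
Qed.

Lemma basic_span_homog n : 'L_n `<=` basic_span n.
Proof.
apply: lin_span_min; first exact: basic_span_subspace.
suff H t : wt t = n -> basic_span n (ev t) by move=> _ [t tn <-]; exact: H.
elim/ltn_ind: n t => n IH [i <-|s t stn].
  exact: (@basic_span_eval (Gen i)).
have sW := basic_span_subspace n; have ws := wt_gt0 s; have wt0 := wt_gt0 t.
have wtE : wt (Br s t) = (wt s + wt t)%N by [].
apply: (span_lie_l sW) (IH (wt s) _ s erefl); last by lia.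
move=> _ [b [Bb wb] <-]; rewrite lieC; apply: (lin_subspaceN sW).
apply: (span_lie_l sW) (IH (wt t) _ t erefl); last by lia.
move=> _ [c [Bc wc] <-]; apply: basic_span_lie => //; last by lia.
by move=> m r mn rm; exact: IH.
Qed.

End BasicCommutators.

(** * Dimensions of quotients *)

Section QuotientDimension.
Variables (F : fieldType) (V : lmodType F).
Implicit Types (A B C : set V).

(** If [k < k'], the matrix of coordinates has a nonzero left kernel, and a nonzero row of it is a
    linear relation modulo [B]. *)
Lemma quot_indep_le B k k' (e : 'I_k -> V) (e' : 'I_k' -> V) :
  lin_subspace B ->
  (forall i, exists c : 'I_k -> F, B (e' i - \sum_(j < k) c j *: e j)) ->
  (forall c : 'I_k' -> F, B (\sum_(i < k') c i *: e' i) -> forall i, c i = 0) ->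
  (k' <= k)%N.
Proof.
move=> sB /choice[c cP] indep; rewrite leqNgt; apply/negP => kk'.
pose M := \matrix_(i, j) c i j.
have : kermx M != 0.
  rewrite kermx_eq0 /row_free neq_ltn.
  by rewrite (leq_ltn_trans (rank_leq_col M) kk').
case/matrix0Pn => i [j]; apply/negP; rewrite negbK; apply/eqP.
apply: (indep (fun j => kermx M i j)).
rewrite (_ : \sum_i0 _ =
    \sum_i0 kermx M i i0 *: (e' i0 - \sum_j0 c i0 j0 *: e j0)).
  by apply: lin_subspace_sum => // l _; exact: lin_subspaceZ.
under [RHS]eq_bigr do rewrite scalerBr scaler_sumr.
rewrite sumrB exchange_big /= [X in _ = _ - X]big1 ?subr0// => l _.
under eq_bigr do rewrite scalerA.
rewrite -scaler_suml (_ : \sum_i0 _ = (kermx M *m M) i l).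
  by rewrite mulmx_ker mxE scale0r.
by rewrite mxE; apply: eq_bigr => m _; rewrite !mxE.
Qed.

Lemma quot_dimE A B k (e : 'I_k -> V) :
  lin_subspace B -> quot_basis A B e -> quot_dim A B = k.
Proof.
move=> sB eb; apply: xget_unique; first by exists e.
move=> k' [e' eb']; have [eA espan eindep] := eb.
have [eA' espan' eindep'] := eb'.
by apply/eqP; rewrite eqn_leq; apply/andP; split;
  [apply: (quot_indep_le sB) eindep' => i; exact: espan
  |apply: (quot_indep_le sB) eindep => i; exact: espan'].
Qed.

Lemma quot_dim_le A B k (e : 'I_k -> V) : lin_subspace B ->
  (forall v, A v -> exists c : 'I_k -> F, B (v - \sum_(j < k) c j *: e j)) ->
  (quot_dim A B <= k)%N.
Proof.
move=> sB espan; rewrite /quot_dim; case: xgetP => // k' _ [e' [Ae' _ indep]].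
by apply: (quot_indep_le sB) indep => i; exact: espan.
Qed.

(** Guards against the junk value of [quot_dim]: independent families in [B / C] have length at most
    [k], and a longest one is a basis. *)
Lemma quot_basis_sub A B C k (e : 'I_k -> V) :
  lin_subspace B -> lin_subspace C -> C `<=` B -> B `<=` A -> quot_basis A C e ->
  exists k' (e' : 'I_k' -> V), quot_basis B C e'.
Proof.
move=> sB sC CB BA [eA espan _].
pose P k' := `[< exists e' : 'I_k' -> V, (forall i, B (e' i)) /\
  forall c : 'I_k' -> F, C (\sum_(i < k') c i *: e' i) -> forall i, c i = 0 >].
have exP : exists k', P k'.
  by exists 0%N; apply/asboolP; exists (fun=> 0); split=> [i|c _ []//];
    exact: (lin_subspace0 sB).
have leP k' : P k' -> (k' <= k)%N.
  move=> /asboolP[e' [Be' indep]].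
  by apply: (quot_indep_le sC) indep => i; apply: espan; exact: BA.
case: (ex_maxnP exP leP) => k' /asboolP[e' [Be' indep]] maxk'.
exists k', e'; split=> // v Bv; apply: contrapT => nspan.
have : P k'.+1; last by move=> /maxk'; rewrite ltnn.
apply/asboolP; exists (fun i => if unlift ord_max i is Some j then e' j else v).
split=> [i|c]; first by case: unliftP => [j _|_].
have wE (i : 'I_k') : widen_ord (leqnSn k') i = lift ord_max i.
  by apply: val_inj; rewrite /= /bump leqNgt ltn_ord.
rewrite big_ord_recr /= unlift_none.
under eq_bigr do rewrite wE liftK.
move=> Cc; have cmax : c ord_max = 0.
  apply/eqP/negPn/negP => c0; apply: nspan.
  exists (fun i => - ((c ord_max)^-1 * c (lift ord_max i))).
  rewrite -[v in v - _](scalerK c0).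
  rewrite (_ : _ - _ = (c ord_max)^-1 *:
    (\sum_(i < k') c (lift ord_max i) *: e' i + c ord_max *: v)).
    exact: lin_subspaceZ.
  rewrite scalerDr addrC scaler_sumr -sumrN; congr (_ + _).
  by apply: eq_bigr => i _; rewrite scaleNr opprK scalerA.
move: Cc; rewrite cmax scale0r addr0 => /(indep (fun j => c (lift ord_max j))) c0 i.
by case: (unliftP ord_max i) => [j ->|->//]; exact: c0.
Qed.

Lemma quot_basis_cat A B C k k' (e : 'I_k -> V) (e' : 'I_k' -> V) :
  lin_subspace B -> C `<=` B -> B `<=` A ->
  quot_basis A B e -> quot_basis B C e' ->
  quot_basis A C (fun i : 'I_(k + k') =>
    match fintype.split i with inl j => e j | inr j => e' j end).
Proof.
move=> sB CB BA [eA espan eindep] [eB' espan' eindep'].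
have sumE (c : 'I_(k + k') -> F) :
    \sum_(i < k + k') c i *: match fintype.split i with inl j => e j | inr j => e' j end =
    \sum_(i < k) c (lshift k' i) *: e i + \sum_(i < k') c (rshift k i) *: e' i.
  rewrite big_split_ord /=; congr (_ + _); apply: eq_bigr => i _.
    by rewrite (unsplitK (inl i)).
  by rewrite (unsplitK (inr i)).
split=> [i|v Av|c].
- by case: (fintype.split i) => j //; exact: BA.
- have [c Bv] := espan v Av; have [c' Cv] := espan' _ Bv.
  exists (fun i => match fintype.split i with inl j => c j | inr j => c' j end).
  rewrite sumE opprD addrA.
  under eq_bigr do rewrite (unsplitK (inl _)).
  by under [X in _ - X]eq_bigr do rewrite (unsplitK (inr _)).
rewrite sumE => Cc.
have c0 : forall i, c (lshift k' i) = 0.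
  apply: (eindep (fun i => c (lshift k' i))).
  rewrite -[X in B X](addrK (\sum_(i < k') c (rshift k i) *: e' i)).
  apply: (lin_subspaceB sB); first exact: CB.
  by apply: lin_subspace_sum => // i _; exact: lin_subspaceZ.
have c0' : forall i, c (rshift k i) = 0.
  apply: (eindep' (fun i => c (rshift k i))).
  by move: Cc; rewrite [X in X + _]big1 ?add0r// => i _; rewrite c0 scale0r.
by move=> i; rewrite -(splitK i); case: (fintype.split i) => j /=; [exact: c0|exact: c0'].
Qed.

Lemma quot_dim_add A B C k r (e : 'I_k -> V) (e' : 'I_r -> V) :
  lin_subspace B -> lin_subspace C -> C `<=` B -> B `<=` A ->
  quot_basis A C e -> quot_basis A B e' -> (r + quot_dim B C)%N = k.
Proof.
move=> sB sC CB BA eb eb'; have [k' [e2 eb2]] := quot_basis_sub sB sC CB BA eb.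
rewrite (quot_dimE sC eb2) -(quot_dimE sC eb).
by rewrite (quot_dimE sC (quot_basis_cat sB CB BA eb' eb2)).
Qed.

End QuotientDimension.

(** * Elimination in homogeneous free families *)

Section Defect.
Variable R : realType.
Implicit Types (t : R) (g : nat -> nat) (n m M K : nat).

(* For a free family with [g m] generators of weight [m], [1 - sum g_m t^m] is
   the inverse of the Hilbert series of the enveloping algebra. *)
Definition defect t g M : R := 1 - \sum_(m < M.+1) (g m)%:R * t ^+ m.

(** At t = 1/d this is 1 for the letters, and it is [K + 1] when there is no generator of weight at
    most [K]. *)
Definition defect_sum t g K : R := \sum_(M < K.+1) defect t g M.

(** For the generating series: g' = g - t^n + t^n g', that is, 1 - g' = (1 - g) / (1 - t^n). The
    lemma [defect_elim] is the truncated form. *)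
Definition elim_count n g g' := forall m,
  g' m = (g m - (m == n) + (if (n <= m)%N then g' (m - n)%N else 0))%N.

Variables (n : nat) (g g' : nat -> nat).
Hypotheses (n_gt0 : (0 < n)%N) (gn_gt0 : (0 < g n)%N) (gg' : elim_count n g g').

Lemma sum_shift (h : nat -> R) M :
  \sum_(m < M.+1) (if (n <= m)%N then h (m - n)%N else 0) =
  if (n <= M)%N then \sum_(m < (M - n).+1) h m else 0.
Proof.
rewrite -(big_mkord predT (fun m => if (n <= m)%N then h (m - n)%N else 0)).
case: leqP => [nM|Mn]; last first.
  by rewrite big_nat big1// => m /andP[_ mM]; case: leqP => // nm; lia.
rewrite (big_cat_nat (n := n))//=; last by lia.
rewrite big_nat big1 ?add0r => [|m /andP[_ mn]]; last by rewrite leqNgt mn.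
rewrite -{1}[n]add0n big_addn big_mkord subSn//.
by apply: eq_bigr => m _; rewrite leq_addl addnK.
Qed.

Lemma defect_elim t M : defect t g' M =
  defect t g M + (if (n <= M)%N then t ^+ n * defect t g' (M - n)%N else 0).
Proof.
have -> : defect t g' M = defect t g M + \sum_(m < M.+1) (m == n :> nat)%:R * t ^+ m -
    \sum_(m < M.+1) (if (n <= m)%N then t ^+ n * ((g' (m - n)%N)%:R * t ^+ (m - n)) else 0).
  rewrite /defect -!addrA; congr (1 + _); rewrite -!sumrN -!big_split /=.
  apply: eq_bigr => m _; rewrite gg' natrD natrB; last by case: eqP => // ->.
  rewrite mulrDl mulrBl opprD opprB addrA; congr (_ - _); first by rewrite addrC.
  case: leqP => nm; last by rewrite mul0r.
  by rewrite mulrCA -exprD subnKC.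
rewrite (sum_shift (fun m => t ^+ n * ((g' m)%:R * t ^+ m))) -addrA; congr (_ + _).
case: leqP => nM; last first.
  rewrite subr0 big1// => m _; case: eqP => [mn|]; last by rewrite mul0r.
  by have := ltn_ord m; lia.
have nM1 : (n < M.+1)%N by lia.
rewrite (bigD1 (Ordinal nM1))//= eqxx mul1r big1 ?addr0; last first.
  by move=> i; rewrite -val_eqE /= => /negPf ->; rewrite mul0r.
by rewrite /defect mulrBr mulr1 mulr_sumr.
Qed.

Lemma defect_elim_ge0 t : 0 <= t ->
  (forall M, 0 <= defect t g M) -> forall M, 0 <= defect t g' M.
Proof.
move=> t0 E0 M; have [k] := ubnP M; elim: k M => // k IH M Mk.
rewrite defect_elim addr_ge0//; case: leqP => // nM.
by rewrite mulr_ge0 ?exprn_ge0//; apply: IH; lia.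
Qed.

(** Sum [defect_elim] over the truncations: the shifted terms form an initial part of
    [defect_sum t g' K], which is at most the whole by nonnegativity. *)
Lemma defect_sum_elim t K : 0 <= t ->
  (forall M, 0 <= defect t g M) ->
  (1 - t ^+ n) * defect_sum t g' K <= defect_sum t g K.
Proof.
move=> t0 E0; have E0' := defect_elim_ge0 t0 E0.
rewrite mulrBl mul1r lerBlDr /defect_sum.
under [leLHS]eq_bigr do rewrite defect_elim.
rewrite big_split /= lerD2l.
rewrite (sum_shift (fun M => t ^+ n * defect t g' M)).
case: leqP => nK; last by rewrite mulr_ge0 ?exprn_ge0// sumr_ge0.
rewrite -mulr_sumr ler_wpM2l ?exprn_ge0//.
rewrite -!(big_mkord predT (defect t g')).
rewrite [leRHS](big_cat_nat (n := (K - n).+1))//=; last by lia.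
by rewrite lerDl sumr_ge0.
Qed.

End Defect.

(** * Free families listed by weight, and elimination steps *)

Section FreeFamilies.
Variables (R : realType) (F : fieldType) (L : lieAlgType F).
Variables (d : nat) (x : 'I_d -> L).
Local Notation "''L_' n" := (lie_homog x n) (at level 8, n at level 2).
Variables (pi : nat -> L -> L) (gr : grading x pi).
Implicit Types (Gs : nat -> seq L).

Definition gens Gs : set L := [set u | exists m, u \in Gs m].

Definition free_fam Gs : Prop :=
  [/\ Gs 0%N = [::], forall m, uniq (Gs m),
      forall m u, u \in Gs m -> 'L_m u & lie_free (gens Gs)].

Definition gcount Gs m := size (Gs m).

Lemma free_fam_homog Gs : free_fam Gs ->
  forall u, gens Gs u -> exists m, 'L_m u.
Proof. by move=> [_ _ hG _] u [m um]; exists m; exact: hG. Qed.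

Lemma free_fam_disjoint Gs m m' u : free_fam Gs ->
  u \in Gs m -> u \in Gs m' -> m = m'.
Proof.
move=> [_ _ hG fG] um um'; apply/eqP/negPn/negP => mm'.
have /eqP := lie_free_neq0 fG (ex_intro _ m um : gens Gs u); apply.
by rewrite -(gr_id gr (hG _ _ um)) (gr_ne gr (hG _ _ um')).
Qed.

Section Lazard.
Variables (Gs : nat -> seq L) (n : nat) (c : L).
Hypotheses (fG : free_fam Gs) (cn : c \in Gs n).

Let n_gt0 : (0 < n)%N.
Proof. by case: fG => G0 _ _ _; move: cn; case: n => //; rewrite G0. Qed.

Let Gc : gens Gs c. Proof. by exists n. Qed.

(** The recursion goes from [m] to [m - n]; as [n > 0], fuel [m] is enough. *)
Fixpoint lazard_fuel k m : seq L :=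
  [seq z <- Gs m | z != c] ++
  (if k is k'.+1 then
     if (n <= m)%N then map (lie c) (lazard_fuel k' (m - n)%N) else [::]
   else [::]).

Definition lazard_fam m := lazard_fuel m m.

Lemma lazard_fuel_stable k k' m : (m <= k)%N -> (m <= k')%N ->
  lazard_fuel k m = lazard_fuel k' m.
Proof.
elim: k k' m => [|k IH] [|k'] m //=.
- by rewrite leqn0 => /eqP -> _; rewrite leqNgt n_gt0.
- by move=> _; rewrite leqn0 => /eqP ->; rewrite leqNgt n_gt0.
move=> mk mk'; case: leqP => // nm; congr (_ ++ map _ _).
by apply: IH; lia.
Qed.

Lemma lazard_famE m : lazard_fam m = [seq z <- Gs m | z != c] ++
  (if (n <= m)%N then map (lie c) (lazard_fam (m - n)%N) else [::]).
Proof.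
rewrite /lazard_fam; case: m => [|m]; first by rewrite leqNgt n_gt0.
rewrite [LHS]/=; case: leqP => // nm; congr (_ ++ map _ _).
by apply: lazard_fuel_stable; lia.
Qed.

Lemma mem_lazard_fam m u : u \in lazard_fam m <->
  exists k z m0, [/\ z \in Gs m0, z != c, u = iter k (lie c) z & m = (m0 + k * n)%N].
Proof.
split.
  have [b] := ubnP m; elim: b m u => // b IH m u mb.
  rewrite lazard_famE mem_cat => /orP[|].
    rewrite mem_filter => /andP[uc um].
    by exists 0%N, u, m; rewrite mul0n addn0.
  case: leqP => // nm /mapP[v /IH]; case; first by lia.
  move=> k [z [m0 [zm0 zc -> mE]]] ->.
  by exists k.+1, z, m0; split=> //; rewrite mulSn; lia.
move=> [k [z [m0 [zm0 zc -> ->]]]]; elim: k => [|k IH].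
  by rewrite mul0n addn0 lazard_famE mem_cat mem_filter zc zm0.
rewrite lazard_famE mem_cat mulSn; apply/orP; right.
rewrite ifT; last by lia.
by rewrite iterS map_f//; move: IH; congr (_ \in lazard_fam _); lia.
Qed.

Lemma gens_lazard_fam : gens lazard_fam = lazard (gens Gs) c.
Proof.
apply/seteqP; split=> u.
  move=> [m /mem_lazard_fam[k [z [m0 [zm0 /eqP zc -> _]]]]].
  by exists k, z; split=> //; exists m0.
move=> [k [z [[m0 zm0] /eqP zc ->]]]; exists (m0 + k * n)%N.
by apply/mem_lazard_fam; exists k, z, m0.
Qed.

Let freeG : lie_free (gens Gs). Proof. by case: fG. Qed.

Lemma lazard_fam_inj k k' z z' m m' : z \in Gs m -> z != c -> z' \in Gs m' ->
  z' != c -> iter k (lie c) z = iter k' (lie c) z' -> z = z' /\ k = k'.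
Proof.
move=> zm /eqP zc zm' /eqP zc'; apply: (lazard_inj freeG Gc) => //.
- by exists m.
- by exists m'.
Qed.

Lemma free_fam_lazard : free_fam lazard_fam.
Proof.
have [G0 uG hG _] := fG; split.
- by rewrite lazard_famE G0 leqNgt n_gt0.
- move=> m; have [b] := ubnP m; elim: b m => // b IH m mb.
  rewrite lazard_famE cat_uniq filter_uniq//=.
  case: leqP => // nm; apply/andP; split.
    apply/hasPn => _ /mapP[v /mem_lazard_fam[k [z [m0 [zm0 zc -> _]]]] ->].
    apply/negP; rewrite mem_filter -iterS => /andP[uc um].
    by have [_] := lazard_fam_inj (k := 0) um uc zm0 zc erefl.
  rewrite map_inj_in_uniq; first by apply: IH; lia.
  move=> _ _ /mem_lazard_fam[k [z [m0 [zm0 zc -> _]]]]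
    /mem_lazard_fam[k' [z' [m0' [zm0' zc' -> _]]]]; rewrite -!iterS.
  by move=> /(lazard_fam_inj zm0 zc zm0' zc')[-> [->]].
- move=> _ u /mem_lazard_fam[k [z [m0 [zm0 zc -> ->]]]].
  elim: k => [|k IH]; first by rewrite mul0n addn0; exact: hG.
  rewrite iterS mulSn addnCA; apply: homog_lie => //; exact: hG.
- by rewrite gens_lazard_fam; exact: lazard_free.
Qed.

Lemma lazard_fam_count : elim_count n (gcount Gs) (gcount lazard_fam).
Proof.
have [_ uG _ _] := fG.
move=> m; rewrite /gcount {1}lazard_famE size_cat; congr (_ + _)%N; last first.
  by case: leqP => //; rewrite size_map.
case: (eqVneq m n) => [->|mn].
  by rewrite -rem_filter// size_rem// subn1.
rewrite subn0; congr size; apply/all_filterP/allP => z zm.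
by apply/eqP => zc; move/eqP: mn; apply; apply: (free_fam_disjoint fG zm); rewrite zc.
Qed.

End Lazard.

(** What is remembered of the elimination of [k] generators of weight [n], in a form that is stable
    under composition. The bound by [t ^+ M] is the gain from removing a letter. *)
Record elim_step n k Gs Gs' : Prop := ElimStep {
  es_free : free_fam Gs';
  es_low : forall m, (m < n)%N -> Gs' m = Gs m;
  es_basis : exists e : 'I_k -> L,
    quot_basis (lie_gen (gens Gs)) (lie_gen (gens Gs')) e;
  es_sub : lie_gen (gens Gs') `<=` lie_gen (gens Gs);
  es_homog : forall m, (n < m)%N -> 'L_m `<=` lie_gen (gens Gs) ->
    'L_m `<=` lie_gen (gens Gs');
  es_defect : forall t : R, 0 < t -> t < 1 ->
    (forall M, 0 <= defect t (gcount Gs) M) ->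
    [/\ forall M, 0 <= defect t (gcount Gs') M,
        forall M, defect t (gcount Gs) M <= defect t (gcount Gs') M,
        n = 1%N -> (0 < k)%N -> forall M, t ^+ M <= defect t (gcount Gs') M
      & forall K, (1 - t ^+ n) ^+ k * defect_sum t (gcount Gs') K <=
          defect_sum t (gcount Gs) K] }.

Lemma quot_basis_refl (A : set L) : A 0 -> quot_basis A A (fun _ : 'I_0 => 0).
Proof. by move=> A0; split=> [//|v Av|c _ []//]; exists (fun=> 0); rewrite big_ord0 subr0. Qed.

Lemma elim_step0 n Gs : free_fam Gs -> elim_step n 0 Gs Gs.
Proof.
move=> fG; split=> //.
  exists (fun=> 0); apply: quot_basis_refl.
  exact: (lin_subspace0 (lie_gen_subspace _)).
by move=> t _ _ E0; split=> // K; rewrite expr0 mul1r.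
Qed.

Lemma elim_step_trans n k k' Gs Gs1 Gs2 :
  elim_step n k Gs Gs1 -> elim_step n k' Gs1 Gs2 -> elim_step n (k + k') Gs Gs2.
Proof.
move=> s1 s2; split.
- exact: es_free s2.
- by move=> m mn; rewrite (es_low s2)// (es_low s1).
- have [e1 b1] := es_basis s1; have [e2 b2] := es_basis s2; eexists.
  apply: quot_basis_cat b1 b2; first exact: lie_gen_subspace.
    exact: es_sub s2.
  exact: es_sub s1.
- exact: subset_trans (es_sub s2) (es_sub s1).
- by move=> m nm Lm; apply: (es_homog s2 nm); exact: (es_homog s1 nm).
- move=> t t0 t1 E0; have [E1 l1 h1 D1] := es_defect s1 t0 t1 E0.
  have [E2 l2 h2 D2] := es_defect s2 t0 t1 E1; split=> // [M|n1|K].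
  - exact: le_trans (l1 M) (l2 M).
  - case: k h1 {s1 D1} => [_|k h1 _ M]; first exact: h2.
    by apply: le_trans (l2 M); exact: h1.
  rewrite exprD -mulrA; apply: le_trans (D1 K).
  by rewrite ler_wpM2l// exprn_ge0// subr_ge0 exprn_ile1// ltW.
Qed.

Lemma elim_one n c Gs : free_fam Gs -> c \in Gs n ->
  exists2 Gs', elim_step n 1 Gs Gs' & Gs' n = [seq z <- Gs n | z != c].
Proof.
move=> fG cn; have [G0 uG hG freeG] := fG.
have Gc : gens Gs c by exists n.
have n_gt0 : (0 < n)%N by move: cn; case: n => //; rewrite G0.
have fG' := free_fam_lazard fG cn.
have E := gens_lazard_fam fG cn.
have C := lazard_fam_count fG cn.
exists (lazard_fam Gs n c); last first.
  have [G'0 _ _ _] := fG'.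
  by rewrite lazard_famE// leqnn subnn G'0 cats0.
split=> //.
- move=> m mn; rewrite lazard_famE// leqNgt mn cats0.
  apply/all_filterP/allP => z zm; apply/eqP => zc.
  by move: mn; rewrite (free_fam_disjoint fG zm (_ : z \in Gs n)) ?ltnn ?zc.
- by exists (fun=> c); rewrite E; exact: lazard_quot_basis.
- by rewrite E; exact: lazard_gen_sub.
(* The component of [u - a *: c] in weight [n] is [- a *: c]. It lies in the subalgebra generated by
   the homogeneous set [lazard], which does not contain [c]; hence [a = 0]. *)
- move=> m nm Lm u Lu; rewrite E.
  have [a lu] := lazard_decomp c (Lm _ Lu).
  have hl : forall v, lazard (gens Gs) c v -> exists m, 'L_m v.
    by rewrite -E; exact: free_fam_homog.
  have := gr_gen gr n hl lu.
  rewrite (grB gr) (grZ gr) (gr_ne gr Lu) ?ltn_eqF// (gr_id gr (hG _ _ cn)) sub0r.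
  have [a0 _|a0 lc] := eqVneq a 0.
    by move: lu; rewrite a0 scale0r subr0.
  exfalso; apply: (lazard_notin freeG Gc).
  have := lin_subspaceZ (- a^-1) (lie_gen_subspace _) lc.
  by rewrite scalerN scaleNr opprK scalerK.
- have gn : (0 < gcount Gs n)%N by rewrite /gcount; case: (Gs n) cn.
  move=> t t0 _ E0; have E0' := defect_elim_ge0 n_gt0 gn C (ltW t0) E0.
  split=> // [M|n1 _ M|K].
  - rewrite (defect_elim n_gt0 gn C) lerDl; case: leqP => // _.
    by rewrite mulr_ge0// exprn_ge0// ltW.
  (* For [n = 1], [defect_elim] shows that the new defect at [M.+1] is at least [t] times the one at
     [M], and at 0 it equals 1. *)
  - elim: M => [|M IH]; last first.
      have -> : t ^+ M.+1 = t ^+ n * t ^+ M by rewrite n1 -exprD.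
      have -> : defect t (gcount (lazard_fam Gs n c)) M.+1 =
          defect t (gcount Gs) M.+1 +
          t ^+ n * defect t (gcount (lazard_fam Gs n c)) M.
        have nM : (n <= M.+1)%N by rewrite n1.
        have nE : (M.+1 - n)%N = M by rewrite n1 subn1.
        by rewrite (defect_elim n_gt0 gn C) nM nE.
      by apply: ler_wpDl => //; rewrite ler_pM2l// exprn_gt0.
    have [G'0 _ _ _] := fG'.
    by rewrite /defect big_ord1 /gcount G'0 mul0r subr0 expr0.
  - by rewrite expr1; exact: (defect_sum_elim n_gt0 gn C _ (ltW t0) E0).
Qed.

Lemma elim_many n cs Gs : free_fam Gs -> uniq cs -> {subset cs <= Gs n} ->
  exists2 Gs', elim_step n (size cs) Gs Gs' & Gs' n = [seq z <- Gs n | z \notin cs].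
Proof.
elim: cs Gs => [|c cs IH] Gs fG /=.
  move=> _ _; exists Gs; first exact: elim_step0.
  by apply/esym/all_filterP/allP.
move=> /andP[ccs ucs] sub.
have [Gs1 s1 G1n] := elim_one fG (sub c (mem_head _ _)).
have [|Gs2 s2 G2n] := IH Gs1 (es_free s1) ucs.
  move=> z zcs; rewrite G1n mem_filter sub ?inE ?zcs ?orbT// andbT.
  by apply: contraNneq ccs => <-.
exists Gs2; first by rewrite -add1n; exact: elim_step_trans s1 s2.
rewrite G2n G1n -filter_predI; apply: eq_filter => z /=.
by rewrite inE negb_or andbC.
Qed.

(** * Exchange of generators for basic commutators *)

Variables (le : rel (liecomm d)) (le_basic : basic_order le).
Local Notation ev := (lie_eval x).

(** The coordinate of [r] is not zero on all basic commutators of weight [n], as these span a space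
    containing [r]. If it is nonzero at [ev t], then [ev t] is a nonzero multiple of [r] modulo the
    other generators, by [gr_gen_split]. The last clause keeps the lists free of duplicates. *)
Lemma exchange_one n r Gs : free_fam Gs -> r \in Gs n ->
  'L_n `<=` lie_gen (gens Gs) ->
  exists t, [/\ basic le t, wt t = n, lie_free (ev t |` (gens Gs `\ r)),
    lie_gen (ev t |` (gens Gs `\ r)) = lie_gen (gens Gs)
    & ~ (gens Gs `\ r) (ev t)].
Proof.
move=> fG rn Ln; have [G0 uG hG freeG] := fG.
have Gr : gens Gs r by exists n.
have [f [fZ fr f0 _]] := lie_free_coord freeG Gr.
have sG := lie_gen_subspace (gens Gs).
have [t [Bt wtn ft]] : exists t, [/\ basic le t, wt t = n & f (ev t) != 0].
  apply: contrapT => nex.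
  have : [set u | lie_gen (gens Gs) u /\ f u = 0] r.
    have := basic_span_homog le_basic (hG _ _ rn).
    apply: lin_span_min.
      apply/lin_subspaceP; split.
        split; first exact: lin_subspace0.
        by apply: f0; exact: (lin_subspace0 (lie_gen_subspace _)).
      move=> a u v [Gu fu] [Gv fv]; split.
        exact: (lin_subspaceD sG (lin_subspaceZ a sG Gu) Gv).
      by rewrite fZ// fu fv mulr0 addr0.
    move=> _ [t [Bt wtn] <-]; split.
      by apply: Ln; rewrite -wtn; exact: (@homog_eval _ _ _ x t).
    by apply/eqP/negPn/negP => ft; apply: nex; exists t.
  by move=> [_]; rewrite fr; apply/eqP; rewrite oner_eq0.
have Lt : 'L_n (ev t) by rewrite -wtn; exact: (@homog_eval _ _ _ x t).
have [a Ga] := gr_gen_split gr (hG _ _ rn) (free_fam_homog fG) (Ln _ Lt) Lt.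
have a0 : a != 0.
  apply: contraNneq ft => a0; apply/eqP; apply: f0.
  by move: Ga; rewrite a0 scale0r subr0.
have [fG1 eG1 nG1] := lie_free_exchange freeG Gr a0 Ga.
by exists t; split=> // Gt; apply: nG1; exact: lie_gen_sub.
Qed.

Lemma exchange_weight n Gs : free_fam Gs -> 'L_n `<=` lie_gen (gens Gs) ->
  exists Gs' ts, [/\ free_fam Gs', lie_gen (gens Gs') = lie_gen (gens Gs),
    forall m, m != n -> Gs' m = Gs m,
    Gs' n = map ev ts /\ size ts = size (Gs n)
    & forall t, t \in ts -> basic le t /\ wt t = n].
Proof.
move=> fG Ln.
suff H rs ts Gs1 : free_fam Gs1 -> 'L_n `<=` lie_gen (gens Gs1) ->
    Gs1 n = map ev ts ++ rs -> (forall t, t \in ts -> basic le t /\ wt t = n) ->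
  exists Gs' ts', [/\ free_fam Gs', lie_gen (gens Gs') = lie_gen (gens Gs1),
    forall m, m != n -> Gs' m = Gs1 m,
    Gs' n = map ev ts' /\ size ts' = (size ts + size rs)%N
    & forall t, t \in ts' -> basic le t /\ wt t = n].
  by have [|Gs' [ts']] := H (Gs n) [::] Gs fG Ln erefl _; last by exists Gs', ts'.
elim: rs ts Gs1 => [|r rs IH] ts Gs1 fG1 Ln1 Gn Bts.
  by exists Gs1, ts; rewrite addn0; split=> //; split=> //; rewrite Gn cats0.
have rn : r \in Gs1 n by rewrite Gn mem_cat mem_head orbT.
have [t [Bt wtn free2 gen2 nt]] := exchange_one fG1 rn Ln1.
pose Gs2 m := if m == n then map ev (rcons ts t) ++ rs else Gs1 m.
have [G0 uG hG freeG] := fG1.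
have un := uG n; rewrite Gn cat_uniq /= negb_or in un.
case/and3P: un => un1 /andP[rts /hasPn disj] /andP[rrs un2].
have GsE : gens Gs2 = ev t |` (gens Gs1 `\ r).
  apply/seteqP; split=> [u [m]|u].
    rewrite /Gs2; case: eqP => [_|mn um]; last first.
      right; split; first by exists m.
      by move=> ur; apply: mn; apply: (free_fam_disjoint fG1 um); rewrite ur.
    rewrite map_rcons cat_rcons mem_cat inE => /or3P[uts|/eqP ->|urs]; last 2 first.
    - by left.
    - right; split; first by exists n; rewrite Gn mem_cat inE urs !orbT.
      by move=> ur; rewrite -ur urs in rrs.
    right; split; first by exists n; rewrite Gn mem_cat uts.
    by move=> ur; rewrite -ur uts in rts.
  move=> [->|[[m um] ur]].
    by exists n; rewrite /Gs2 eqxx map_rcons cat_rcons mem_cat mem_head orbT.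
  exists m; rewrite /Gs2; case: eqP => // mn.
  move: um; rewrite mn Gn map_rcons cat_rcons !mem_cat !inE.
  by move=> /or3P[->//|/eqP//|->]; rewrite !orbT.
have fG2 : free_fam Gs2.
  split; last by rewrite GsE.
  - by rewrite /Gs2; case: eqP => // n0; have := wt_gt0 t; rewrite wtn -n0.
  - move=> m; rewrite /Gs2; case: eqP => // _.
    rewrite map_rcons cat_rcons cat_uniq /= un1 un2 negb_or andbT /=.
    rewrite -andbA; apply/and3P; split.
    + apply/negP => tin; apply: nt; split.
        by exists n; rewrite Gn mem_cat tin.
      by move=> tr; rewrite tr (negPf rts) in tin.
    + by apply/hasPn => v /disj.
    + apply/negP => tin; apply: nt; split.
        by exists n; rewrite Gn mem_cat inE tin !orbT.
      by move=> tr; rewrite tr (negPf rrs) in tin.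
  - move=> m u; rewrite /Gs2; case: eqP => [->|_]; last exact: hG.
    rewrite map_rcons cat_rcons mem_cat inE => /or3P[uts|/eqP ->|urs].
    + by apply: hG; rewrite Gn mem_cat uts.
    + by rewrite -wtn; exact: (@homog_eval _ _ _ x t).
    + by apply: hG; rewrite Gn mem_cat inE urs !orbT.
have [||u|Gs3 [ts3 [h1 h2 h3 [h4 h5] h6]]] := IH (rcons ts t) Gs2 fG2.
- by rewrite GsE gen2.
- by rewrite /Gs2 eqxx.
- by rewrite mem_rcons inE => /orP[/eqP ->//|/Bts].
exists Gs3, ts3; split=> //.
- by rewrite h2 GsE.
- by move=> m mn; rewrite h3// /Gs2 (negPf mn).
- by rewrite h5 size_rcons /= addSnnS.
Qed.

(** Exchange comes before elimination, so that the generators kept in weight [n] are basic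
    commutators; later eliminations act in higher weights and leave them alone. *)
Lemma elim_weight n j Gs : free_fam Gs -> 'L_n `<=` lie_gen (gens Gs) ->
  (j <= size (Gs n))%N ->
  exists Gs' ts, [/\ elim_step n j Gs Gs', Gs' n = map ev ts,
    size ts = (size (Gs n) - j)%N & forall t, t \in ts -> basic le t /\ wt t = n].
Proof.
move=> fG Ln jn.
have [Gs1 [ts [fG1 gen1 low1 [G1n sz] Bts]]] := exchange_weight fG Ln.
have ev_drop i : map ev (drop i ts) = drop i (Gs1 n) by rewrite G1n map_drop.
have un : uniq (Gs1 n) by case: fG1.
have sz1 : size (Gs1 n) = size (Gs n) by rewrite G1n size_map.
have [Gs2 s2 G2n] := elim_many fG1 (take_uniq j un) (@mem_take _ _ _).
exists Gs2, (drop j ts); split.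
- have cE : gcount Gs1 = gcount Gs.
    apply/funext => m; rewrite /gcount; have [->|mn] := eqVneq m n; first by [].
    by rewrite low1.
  rewrite size_take sz1 in s2.
  have {}s2 : elim_step n j Gs1 Gs2.
    by move: s2; case: ltnP => // nj; rewrite (@anti_leq j (size (Gs n))) // jn.
  split.
  + exact: es_free s2.
  + by move=> m mn; rewrite (es_low s2)// low1// ltn_eqF.
  + by rewrite -gen1; exact: es_basis s2.
  + by rewrite -gen1; exact: es_sub s2.
  + by rewrite -gen1; exact: es_homog s2.
  + by rewrite -cE; exact: es_defect s2.
- rewrite G2n ev_drop; move: un; have := cat_take_drop j (Gs1 n).
  set T := take j _; set D := drop j _ => <-.
  rewrite cat_uniq filter_cat => /and3P[_ /hasPn disj _].
  rewrite (_ : [seq z <- T | z \notin T] = [::]).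
    by apply/all_filterP/allP => z /disj.
  by apply/eqP; rewrite -(negbK (_ == _)) -has_filter; apply/hasPn => z /= ->.
- by rewrite size_drop sz.
- by move=> t /mem_drop /Bts.
Qed.

End FreeFamilies.

(** * Growth estimates and lower limits *)

Lemma dependent_choice_nat (T : Type) (P : nat -> T -> Prop)
    (A : nat -> T -> T -> Prop) (s0 : T) :
  P 0%N s0 -> (forall n s, P n s -> exists2 s', A n s s' & P n.+1 s') ->
  exists st : nat -> T, st 0%N = s0 /\
    forall n, P n (st n) /\ A n (st n) (st n.+1).
Proof.
move=> P0 PA.
have /choice[f fP] : forall p : nat * T, exists s',
    P p.1 p.2 -> A p.1 p.2 s' /\ P p.1.+1 s'.
  move=> [n s]; have [/PA[s' As' Ps']|nP] := pselect (P n s); first by exists s'.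
  by exists s.
pose fix st n := if n is n'.+1 then f (n', st n') else s0.
exists st; split=> //.
have Pst n : P n (st n) by elim: n => //= n /(fP (n, st n))[].
by move=> n; split=> //; case: (fP (n, st n) (Pst n)).
Qed.

Section Growth.
Variable R : realType.
Implicit Types (q rho C : R) (l : nat -> nat).

Lemma geometric_le q n : 0 <= q -> q < 1 -> \sum_(m < n) q ^+ m <= (1 - q)^-1.
Proof.
move=> q0 q1; rewrite -[leRHS]mul1r ler_pdivlMr ?subr_gt0// mulrC.
by rewrite -opprB mulNr -subrX1 opprB gerBl exprn_ge0.
Qed.

(** The geometric sum is at most [rho / (rho - 1)] times [rho ^+ n], and [rho / (rho - 1) <= 3] for
    [rho >= 3 / 2]. *)
Lemma sum_power_le rho n : 3 / 2 <= rho ->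
  \sum_(m < n) rho ^+ m.+1 <= 3 * rho ^+ n.
Proof.
move=> hr; have r0 : 0 <= rho by lra.
elim: n => [|n IH]; first by rewrite big_ord0 expr0; lra.
rewrite big_ord_recr /=; have := exprn_ge0 n r0; rewrite exprS; nra.
Qed.

(** Combine [exp (2 y) >= 1 + 2 y] with [(1 + 2 y) (1 - y) = 1 + y (1 - 2 y) >= 1]. *)
Lemma expR_le_1B (y : R) : 0 <= y -> y <= 2^-1 -> expR (- (2 * y)) <= 1 - y.
Proof.
move=> y0 y1; rewrite expRN -[leRHS]invrK lef_pV2 ?posrE ?expR_gt0//; last first.
  by rewrite invr_gt0; lra.
apply: le_trans (expR_ge1Dx _).
by rewrite -[leLHS]mul1r ler_pdivrMr; nra.
Qed.

(* As [1 - y >= exp (- 2 y)] for small [y], the products stay away from 0 if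
   [l m q^m] is summable. *)
Lemma subexponential_absurd q rho C l N0 :
  0 < q -> q <= 2^-1 -> 3 / 2 <= rho -> q * rho < 1 ->
  (forall n, (N0 <= n)%N -> (\sum_(m < n) l m)%:R <= C * rho ^+ n) ->
  (forall n, (\prod_(m < n) (1 - q ^+ m.+1) ^+ l m) * n.+1%:R <= 1) -> False.
Proof.
move=> q0 qh hr qr1 bC prodle.
have r1 : 1 <= rho by lra.
pose b n := (\sum_(m < n) l m)%N.
have b_mono m n : (m <= n)%N -> (b m <= b n)%N.
  move=> mn; rewrite /b -!(big_mkord predT l) [leqRHS](big_cat_nat (n := m))//=.
  exact: leq_addr.
(* [D] extends the bound to the finitely many [n < N0]. *)
pose D := `|C| + (b N0)%:R.
have D0 : 0 <= D by rewrite addr_ge0.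
have bD n : (b n)%:R <= D * rho ^+ n.
  have rn1 : 1 <= rho ^+ n by exact: exprn_ege1.
  rewrite mulrDl; have [N0n|nN0] := leqP N0 n.
    apply: ler_wpDr; first by rewrite mulr_ge0//; lra.
    apply: (le_trans (bC n N0n)); rewrite ler_wpM2r//; first by lra.
    exact: ler_norm.
  apply: ler_wpDl; first by rewrite mulr_ge0//; lra.
  apply: (@le_trans _ _ (b N0)%:R); first by rewrite ler_nat b_mono// ltnW.
  by rewrite ler_peMr.
have lq m : (l m)%:R * q ^+ m.+1 <= D * (q * rho) ^+ m.+1.
  rewrite exprMn mulrCA mulrC ler_pM2l ?exprn_gt0//.
  by apply: le_trans (bD m.+1); rewrite ler_nat /b big_ord_recr leq_addl.
pose E := D * (1 - q * rho)^-1.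
have qr0 : 0 <= q * rho by rewrite mulr_ge0//; lra.
have sumE n : \sum_(m < n) (l m)%:R * q ^+ m.+1 <= E.
  apply: (@le_trans _ _ (D * \sum_(m < n.+1) (q * rho) ^+ m)).
    rewrite big_ord_recl mulrDr mulr_sumr.
    apply: ler_wpDl; first by rewrite mulr_ge0// exprn_ge0.
    by apply: ler_sum => m _; exact: lq.
  by rewrite ler_wpM2l// geometric_le.
have prodge n : expR (- (2 * E)) <= \prod_(m < n) (1 - q ^+ m.+1) ^+ l m.
  apply: (@le_trans _ _ (expR (- (2 * \sum_(m < n) (l m)%:R * q ^+ m.+1)))).
    by rewrite ler_expR lerN2 ler_wpM2l.
  rewrite mulr_sumr -sumrN expR_sum; apply: ler_prod => m _.
  rewrite expR_ge0 /=.
  have -> : - (2 * ((l m)%:R * q ^+ m.+1)) = (- (2 * q ^+ m.+1)) * (l m)%:R by ring.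
  rewrite expRM_natr lerXn2r ?nnegrE ?expR_ge0//.
    rewrite subr_ge0 exprS; have := exprn_ile1 m (ltW q0) (_ : q <= 1).
    by have := exprn_ge0 m (ltW q0); nra.
  apply: expR_le_1B; first by rewrite exprn_ge0 ?ltW.
  rewrite exprS; have := exprn_ile1 m (ltW q0) (_ : q <= 1).
  by have := exprn_ge0 m (ltW q0); nra.
(* The products stay above [exp (- 2 E)], which contradicts the hypothesis once [n] exceeds
   [exp (2 E)]. *)
have /archi_boundP := expR_ge0 (2 * E).
set N := Num.bound _ => hN.
have := le_trans (ler_wpM2r (ler0n R N.+1) (prodge N)) (prodle N).
rewrite expRN mulrC ler_pdivrMr ?expR_gt0// mul1r leNgt.
by rewrite (lt_trans hN)// ltr_nat.
Qed.

Lemma limn_inf_eq (u : nat -> R) (a : R) :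
  (exists N, forall n, (N <= n)%N -> a <= u n) ->
  (forall e N, 0 < e -> exists2 n, (N <= n)%N & u n <= a + e) ->
  limn_inf u = a.
Proof.
move=> [N0 au] ua.
have infE n : (N0 <= n)%N -> infs u n = a.
  move=> N0n; have lb : lbound (sdrop u n) a.
    by move=> _ [m /= nm <-]; apply: au; exact: leq_trans nm.
  have ne : has_inf (sdrop u n).
    by split; [exists (u n); exists n => /=|exists a].
  apply/eqP; rewrite eq_le; apply/andP; split; last first.
    by apply: lb_le_inf => //; case: ne.
  apply/ler_addgt0Pr => e e0; have [m nm um] := ua e n e0.
  by apply: le_trans um; apply: ge_inf; [case: ne|exists m].
rewrite /limn_inf; apply: cvg_lim => //.
apply: (@cvg_near_cst _ _ _ _ _).
by near=> n; rewrite infE//; near: n; exists N0.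
Unshelve. all: by end_near.
Qed.

Lemma limn_inf_itv (u : nat -> R) : (forall n, 0 <= u n <= 1) ->
  0 <= limn_inf u <= 1.
Proof.
move=> u01.
have bu : bounded_fun u.
  exists 1; split; first exact: real1.
  by move=> y y1 n _ /=; have /andP[u0 u1] := u01 n; rewrite ger0_norm//; lra.
have i01 n : 0 <= infs u n <= 1.
  have lb : lbound (sdrop u n) 0 by move=> _ [m _ <-]; case/andP: (u01 m).
  have un : sdrop u n (u n) by exists n => /=.
  apply/andP; split; first by apply: lb_le_inf => //; exists (u n).
  apply: (@le_trans _ _ (u n)); last by case/andP: (u01 n).
  by apply: ge_inf => //; exists 0.
have hs : has_sup (range (infs u)).
  split; first by exists (infs u 0%N); exists 0%N.
  by exists 1 => _ [n _ <-]; case/andP: (i01 n).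
rewrite limn_infE//; apply/andP; split.
  apply: (@le_trans _ _ (infs u 0%N)); first by case/andP: (i01 0%N).
  by apply: ub_le_sup; [case: hs|exists 0%N].
by apply: ge_sup => [|_ [n _ <-]]; [case: hs|case/andP: (i01 n)].
Qed.

End Growth.

(** * Iterated elimination *)

Section EliminationProcess.
Variables (R : realType) (F : fieldType) (L : lieAlgType F).
Variables (d : nat) (x : 'I_d -> L).
Local Notation "''L_' n" := (lie_homog x n) (at level 8, n at level 2).
Variables (pi : nat -> L -> L) (gr : grading x pi).

Section Process.
Variables (st : nat -> nat -> seq L) (k : nat -> nat).
Hypothesis st0_free : free_fam x (st 0%N).
Hypothesis st_step : forall n, elim_step R x n.+1 (k n) (st n) (st n.+1).

Lemma process_free n : free_fam x (st n).
Proof. by case: n => // n; exact: es_free (st_step n). Qed.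

Lemma process_stable n n' m : (m <= n)%N -> (n <= n')%N -> st n' m = st n m.
Proof.
move=> mn /subnKC <-; elim: (n' - n)%N => [|i IH]; first by rewrite addn0.
by rewrite addnS (es_low (st_step _))// ltnS (leq_trans mn)// leq_addr.
Qed.

Lemma process_sub n : lie_gen (gens (st n)) `<=` lie_gen (gens (st 0%N)).
Proof. by elim: n => // n IH; apply: subset_trans (es_sub (st_step n)) IH. Qed.

Lemma process_homog n m : (n < m)%N -> 'L_m `<=` lie_gen (gens (st 0%N)) ->
  'L_m `<=` lie_gen (gens (st n)).
Proof.
move=> nm Lm; elim: n nm => // n IH nm.
by apply: (es_homog (st_step n)) => //; apply: IH; exact: ltnW.
Qed.

Lemma process_basis n : exists e : 'I_(\sum_(m < n) k m) -> L,
  quot_basis (lie_gen (gens (st 0%N))) (lie_gen (gens (st n))) e.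
Proof.
elim: n => [|n [e eb]].
  rewrite big_ord0; exists (fun=> 0); apply: quot_basis_refl.
  exact: (lin_subspace0 (lie_gen_subspace _)).
rewrite big_ord_recr /=; have [e' eb'] := es_basis (st_step n); eexists.
apply: quot_basis_cat eb eb'; first exact: lie_gen_subspace.
  exact: es_sub (st_step n).
exact: process_sub.
Qed.

Variable t : R.
Hypotheses (t_gt0 : 0 < t) (t_lt1 : t < 1).
Hypothesis defect_ge0 : forall M, 0 <= defect t (gcount (st 0%N)) M.

Lemma process_defect_ge0 n M : 0 <= defect t (gcount (st n)) M.
Proof.
elim: n M => // n IH.
by have [] := es_defect (st_step n) t_gt0 t_lt1 IH.
Qed.

Lemma process_defect_low n M : (0 < k 0)%N -> (0 < n)%N ->
  t ^+ M <= defect t (gcount (st n)) M.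
Proof.
move=> k0; elim: n => // -[_ _|n IH _].
  have [_ _ + _] := es_defect (st_step 0) t_gt0 t_lt1 (process_defect_ge0 0).
  exact.
have [_ le _ _] := es_defect (st_step n.+1) t_gt0 t_lt1 (process_defect_ge0 n.+1).
exact: le_trans (IH isT) (le M).
Qed.

Lemma process_defect_sum n K :
  (\prod_(m < n) (1 - t ^+ m.+1) ^+ k m) * defect_sum t (gcount (st n)) K <=
  defect_sum t (gcount (st 0%N)) K.
Proof.
elim: n => [|n IH]; first by rewrite big_ord0 mul1r.
apply: le_trans IH; rewrite big_ord_recr /= -mulrA ler_wpM2l//.
  apply: prodr_ge0 => m _.
  by rewrite exprn_ge0// subr_ge0 exprn_ile1// ltW.
have [_ _ _] := es_defect (st_step n) t_gt0 t_lt1 (process_defect_ge0 n).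
exact.
Qed.

End Process.

(** All generators of weight 1, 2, ... are removed in turn. Stage [n] then lives in weights greater
    than [n], so the removed generators measure dimensions. *)
Lemma full_elimination Gs : free_fam x Gs -> exists st : nat -> nat -> seq L,
  [/\ st 0%N = Gs,
      forall n, elim_step R x n.+1 (gcount (st n) n.+1) (st n) (st n.+1)
    & forall n m, (m <= n)%N -> st n m = [::]].
Proof.
move=> fG.
have [||st [st0 stP]] := @dependent_choice_nat _
  (fun n s => free_fam x s /\ forall m, (m <= n)%N -> s m = [::])
  (fun n s s' => elim_step R x n.+1 (gcount s n.+1) s s') Gs.
- by split=> // m; rewrite leqn0 => /eqP ->; case: fG.
- move=> n s [fs s0]; have us : uniq (s n.+1) by case: fs.
  have [s' ss' s'n] := elim_many R gr fs us (fun z zs => zs).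
  exists s' => //; split; first exact: es_free ss'.
  move=> m; rewrite leq_eqVlt => /predU1P[->|mn].
    by rewrite s'n; apply/eqP; rewrite -(negbK (_ == _)) -has_filter;
      apply/hasPn => z /= ->.
  by rewrite (es_low ss')// s0.
exists st; split=> //; first by move=> n; case: (stP n).
by move=> n m; case: (stP n) => -[_ h _]; exact: h.
Qed.

Lemma full_elimination_sub st n : free_fam x (st n) ->
  (forall m, (m <= n)%N -> st n m = [::]) ->
  lie_gen (gens (st n)) `<=` lie_gt x n.
Proof.
move=> [_ _ hG _] st0; apply: lie_gen_min; first exact: (lie_ge_subalg gr).
move=> u [m um]; have [mn|nm] := leqP m n; first by rewrite st0 in um.
by apply: (lie_ge_homog nm); exact: hG.
Qed.

(* The dimension counts the generators met by the full elimination, and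
   [defect >= 0] bounds their number in each weight. *)
Lemma quot_dim_gt_le Gs t n : free_fam x Gs -> 0 < t -> t < 1 ->
  (forall M, 0 <= defect t (gcount Gs) M) ->
  (quot_dim (sum_set (lie_gen (gens Gs)) (lie_gt x n)) (lie_gt x n))%:R <=
  \sum_(m < n) (t^-1) ^+ m.+1 :> R.
Proof.
move=> fG t0 t1 E0; have [st [st0 stP st_nil]] := full_elimination fG.
have fst0 : free_fam x (st 0%N) by rewrite st0.
have Est : forall M, 0 <= defect t (gcount (st 0%N)) M by rewrite st0.
have [e [_ espan _]] := process_basis stP n.
apply: (@le_trans _ _ (\sum_(m < n) gcount (st m) m.+1)%:R).
  rewrite ler_nat; apply: (quot_dim_le (e := e)) => [|v [u Gu [w Lw <-]]].
    exact: lie_ge_subspace.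
  have [|c Gc] := espan u; first by rewrite st0.
  exists c; rewrite addrAC; apply: (lin_subspaceD (lie_ge_subspace _ _)) => //.
  by apply: full_elimination_sub Gc; [exact: (process_free fst0 stP)|exact: st_nil].
rewrite natr_sum; apply: ler_sum => m _.
have := process_defect_ge0 stP t0 t1 Est m m.+1.
rewrite /defect subr_ge0 big_ord_recr /= => le1.
have : (gcount (st m) m.+1)%:R * t ^+ m.+1 <= 1.
  apply: le_trans le1; rewrite lerDr sumr_ge0// => i _.
  by rewrite mulr_ge0// exprn_ge0// ltW.
by rewrite exprVn -ler_pdivlMr ?exprn_gt0// mul1r.
Qed.

End EliminationProcess.

(** * A lower bound for the growth of the free Lie algebra *)

Section FreeLie.
Variables (R : realType) (F : fieldType) (L : lieAlgType F).
Variables (d : nat) (x : 'I_d -> L).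
Hypotheses (d_ge2 : (2 <= d)%N) (freeL : free_on [set: L] [set: 'I_d] x).
Local Notation q := (d%:R^-1 : R).
Variables (pi : nat -> L -> L) (gr : grading x pi).

Definition letters n : seq L :=
  if n == 1%N then [seq x i | i <- enum 'I_d] else [::].

Lemma free_on_inj : injective x.
Proof.
have [_ _ fr] := freeL; move=> i j xij.
have [f [_ fx _]] := fr (abelian_lie F) (fun l => if l == i then 1 else 0 : F).
have := fx j I; rewrite -xij fx// eqxx; case: eqP => // _ /eqP.
by rewrite oner_eq0.
Qed.

Lemma gens_letters : gens letters = range x.
Proof.
apply/seteqP; split=> [u [m]|_ [i _ <-]].
  by rewrite /letters; case: eqP => // _ /mapP[i _ ->]; exists i.
by exists 1%N; rewrite /letters eqxx map_f// mem_enum.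
Qed.

Lemma gen_letters : lie_gen (gens letters) = [set: L].
Proof. by rewrite gens_letters; exact: free_on_generates. Qed.

Lemma letters_free : free_fam x letters.
Proof.
split=> //.
- move=> m; rewrite /letters; case: eqP => // _.
  by rewrite map_inj_uniq ?enum_uniq//; exact: free_on_inj.
- move=> m u; rewrite /letters; case: eqP => // -> /mapP[i _ ->].
  exact: (@homog_eval _ _ _ x (Gen i)).
- move=> K y; rewrite gen_letters; have [_ _ fr] := freeL.
  have [f [hf fx _]] := fr K (y \o x).
  exists f; split=> // u; rewrite gens_letters => -[i _ <-]; exact: fx.
Qed.

Lemma q_gt0 : 0 < q. Proof. by rewrite invr_gt0 ltr0n; lia. Qed.

Lemma q_le_half : q <= 2^-1.
Proof. by rewrite lef_pV2 ?posrE ?ltr0n// ?ler_nat//; lia. Qed.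

Lemma q_lt1 : q < 1. Proof. by have := q_le_half; lra. Qed.

Lemma defect_letters M : defect q (gcount letters) M = (M == 0%N)%:R.
Proof.
rewrite /defect; case: M => [|M]; first by rewrite big_ord1 /= mul0r subr0.
rewrite !big_ord_recl big1 => [|i _]; last by rewrite mul0r.
rewrite /= mul0r add0r addr0 /gcount /letters /= size_map size_enum_ord.
by rewrite expr1 divff ?subrr// pnatr_eq0; lia.
Qed.

(** [l m] is the number of generators of weight [m.+1] met when [L] is eliminated completely. Each
    of them costs a factor [1 - q ^+ m.+1], while the defect sum rises from 1 to [n.+1]. *)
Lemma lie_dim : exists l : nat -> nat,
  (forall n, exists e : 'I_(\sum_(m < n) l m) -> L,
     quot_basis [set: L] (lie_gt x n) e) /\
  (forall n, (\prod_(m < n) (1 - q ^+ m.+1) ^+ l m) * n.+1%:R <= 1).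
Proof.
have [st [st0 stP st_nil]] := full_elimination R gr letters_free.
have fst0 : free_fam x (st 0%N) by rewrite st0; exact: letters_free.
have E0 M : 0 <= defect q (gcount (st 0%N)) M by rewrite st0 defect_letters.
exists (fun n => gcount (st n) n.+1); split=> n.
  have [e eb] := process_basis stP n; exists e; move: eb.
  rewrite st0 gen_letters.
  suff -> : lie_gen (gens (st n)) = lie_gt x n by [].
  apply/seteqP; split.
    exact: (full_elimination_sub gr (process_free fst0 stP n) (st_nil n)).
  apply: lin_span_min; first exact: lie_gen_subspace.
  move=> u [m /= nm Lm]; apply: (process_homog stP nm) Lm => v _.
  by rewrite st0 gen_letters.
have := process_defect_sum stP q_gt0 q_lt1 E0 n n.
rewrite st0 /defect_sum [leRHS](_ : _ = 1); last first.
  by rewrite big_ord_recl defect_letters big1 ?addr0// => i _; rewrite defect_letters.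
rewrite [X in _ * X](eq_bigr (fun=> 1)) ?sumr_const ?card_ord// => M _.
rewrite /defect big1 ?subr0// => m _; rewrite /gcount st_nil ?mul0r//.
by have := ltn_ord m; have := ltn_ord M; lia.
Qed.

End FreeLie.

(** * The limit of the stages *)

Section LimitProcess.
Variables (R : realType) (F : fieldType) (L : lieAlgType F).
Variables (d : nat) (x : 'I_d -> L).
Variables (pi : nat -> L -> L) (gr : grading x pi).
Variables (st : nat -> nat -> seq L) (k : nat -> nat).
Hypotheses (st0_free : free_fam x (st 0%N)) (st0_gen : lie_gen (gens (st 0%N)) = setT).
Hypothesis st_step : forall n, elim_step R x n.+1 (k n) (st n) (st n.+1).

(** The diagonal, because weight [m] is final from stage [m] on. *)
Definition limit_fam m : seq L := st m m.

Lemma limit_famE n m : (m <= n)%N -> st n m = limit_fam m.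
Proof. by move=> mn; rewrite (process_stable st_step (leqnn m) mn). Qed.

Lemma process_gt n : lie_gt x n `<=` lie_gen (gens (st n)).
Proof.
apply: lin_span_min; first exact: lie_gen_subspace.
move=> u [m /= nm Lm]; apply: (process_homog st_step nm) Lm => v _.
by rewrite st0_gen.
Qed.

Lemma limit_sub n : lie_gen (gens limit_fam) `<=` lie_gen (gens (st n)).
Proof.
apply: lie_gen_mono => u [m um]; have [mn|nm] := leqP m n.
  by apply: lie_gen_sub; exists m; rewrite limit_famE.
apply: process_gt; apply: (lie_ge_homog nm).
by have [_ _ hG _] := process_free st0_free st_step m; exact: hG.
Qed.

(** At stage [n] the weights up to [n] are final and all of [lie_gt x n] is still present. Hence
    codimensions modulo [lie_gt x n] can be computed at stage [n]. *)
Lemma limit_sum n :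
  sum_set (lie_gen (gens limit_fam)) (lie_gt x n) = lie_gen (gens (st n)).
Proof.
have sM := lie_gen_subalg (gens limit_fam).
have sL := lie_ge_subspace x n.+1.
apply/seteqP; split=> [_ [u Mu [v Lv <-]]|].
  apply: (lin_subspaceD (lie_gen_subspace _)); first exact: limit_sub.
  exact: process_gt.
apply: lie_gen_min.
  by apply: (lie_subalg_sum_ideal sM sL) => u v; exact: (lie_ge_ideal gr).
move=> u [m um]; have [mn|nm] := leqP m n.
  by apply: sum_setl => //; apply: lie_gen_sub; exists m; rewrite -(limit_famE mn).
apply: sum_setr; first by case: sM.
apply: (lie_ge_homog nm).
by have [_ _ hG _] := process_free st0_free st_step n; exact: hG.
Qed.

(* On a fixed element of the limit algebra the homomorphisms extending [y] by 0
   from the stages of the process are eventually constant. *)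
Lemma limit_free : free_fam x limit_fam.
Proof.
have fr n := process_free st0_free st_step n.
split; first by case: (fr 0%N).
- by move=> m; case: (fr m) => _ /(_ m).
- by move=> m; case: (fr m) => _ _ /(_ m).
move=> K y.
pose yn n u := if `[< exists2 m, (m <= n)%N & u \in limit_fam m >] then y u else 0.
have /choice[f fP] : forall n, exists f : L -> K,
    lie_hom_on (lie_gen (gens (st n))) f /\
    forall u, gens (st n) u -> f u = yn n u.
  by move=> n; case: (fr n) => _ _ _; exact.
pose P u v := exists N, forall n, (N <= n)%N -> f n u = v.
pose g u : K := xget 0 [set v | P u v].
have gE u v : P u v -> g u = v.
  move=> Pu; apply: xget_unique => // w [N1 h1]; have [N2 h2] := Pu.
  by rewrite -(h1 (maxn N1 N2)) ?leq_maxl// h2// leq_maxr.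
have hM n := lie_homS (@limit_sub n) (fP n).1.
have PZ a u v fu fv : lie_gen (gens limit_fam) u -> lie_gen (gens limit_fam) v ->
    P u fu -> P v fv -> P (a *: u + v) (a *: fu + fv).
  move=> Mu Mv [N1 h1] [N2 h2]; exists (maxn N1 N2) => n.
  by rewrite geq_max => /andP[/h1 <- /h2 <-]; exact: (hM n).1.
have Pl u v fu fv : lie_gen (gens limit_fam) u -> lie_gen (gens limit_fam) v ->
    P u fu -> P v fv -> P (lie u v) (lie fu fv).
  move=> Mu Mv [N1 h1] [N2 h2]; exists (maxn N1 N2) => n.
  by rewrite geq_max => /andP[/h1 <- /h2 <-]; exact: (hM n).2.
have Py u : gens limit_fam u -> P u (y u).
  move=> [m um]; exists m => n mn; rewrite (fP n).2 /yn.
    by case: asboolP => // -[]; exists m.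
  by exists m; rewrite limit_famE.
have Pg u : lie_gen (gens limit_fam) u -> P u (g u).
  move=> Mu; suff [v Pv] : exists v, P u v by rewrite (gE _ _ Pv).
  apply: (@lie_gen_ind _ _ (gens limit_fam) (fun u => exists v, P u v)) Mu.
  - exists 0, 0%N => n _; exact: (lie_hom0 (lie_gen_subalg _) (fP n).1).
  - by move=> v /Py Pv; exists (y v).
  - by move=> a v w Mv Mw [fv Pv] [fw Pw]; eexists; exact: PZ Pv Pw.
  - by move=> v w Mv Mw [fv Pv] [fw Pw]; eexists; exact: Pl Pv Pw.
exists g; split; last by move=> u /Py; exact: gE.
split=> [a u v Mu Mv|u v Mu Mv]; apply: gE.
- by apply: PZ => //; exact: Pg.
- by apply: Pl => //; exact: Pg.
Qed.

End LimitProcess.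

(** * The greedy choice of codimensions *)

Section Greedy.
Variables (R : realType) (F : fieldType) (L : lieAlgType F).
Variables (d : nat) (x : 'I_d -> L).
Hypotheses (d_ge2 : (2 <= d)%N) (freeL : free_on [set: L] [set: 'I_d] x).
Local Notation "''L_' n" := (lie_homog x n) (at level 8, n at level 2).
Variables (pi : nat -> L -> L) (gr : grading x pi).
Variables (le : rel (liecomm d)) (le_basic : basic_order le).
Local Notation ev := (lie_eval x).

(* [C n r] says that codimension [r] is admissible in weights at most [n]. One
   generator of weight 1 is removed in any case; later on as many generators
   are removed as is admissible. *)
Lemma greedy_process (C : nat -> nat -> bool) :
  exists (st : nat -> nat -> seq L) (k : nat -> nat) (ts : nat -> seq (liecomm d)),
  [/\ st 0%N = letters x, k 0%N = 1%N,
      forall n, elim_step R x n.+1 (k n) (st n) (st n.+1),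
      forall n, st n.+1 n.+1 = map ev (ts n) /\
        forall t, t \in ts n -> basic le t /\ wt t = n.+1
    & forall n, (0 < n)%N ->
        (C n.+1 (\sum_(m < n.+1) k m) \/ k n = 0)%N /\
        (st n.+1 n.+1 = [::] \/ ~~ C n.+1 (\sum_(m < n.+1) k m).+1%N)].
Proof.
(* A state holds the family, the codimension reached so far, the number of generators just removed
   and the commutators just kept. *)
pose T := ((nat -> seq L) * nat * nat * seq (liecomm d))%type.
pose G (s : T) := s.1.1.1; pose r (s : T) := s.1.1.2.
pose k (s : T) := s.1.2; pose ts (s : T) := s.2.
have fX := letters_free freeL.
have [||st [st0 stP]] := @dependent_choice_nat T
  (fun n s => [/\ free_fam x (G s), (forall m, (n < m)%N -> 'L_m `<=` lie_gen (gens (G s)))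
     & n = 0%N -> G s = letters x])
  (fun n s s' => [/\ r s' = (r s + k s')%N, elim_step R x n.+1 (k s') (G s) (G s'),
     G s' n.+1 = map ev (ts s'), (forall t, t \in ts s' -> basic le t /\ wt t = n.+1)
   & if n is 0 then k s' = 1%N else
     (C n.+1 (r s') \/ k s' = 0)%N /\ (G s' n.+1 = [::] \/ ~~ C n.+1 (r s').+1)])
  (letters x, 0%N, 0%N, [::]).
- by split=> // m _ u _; rewrite /G /= gen_letters.
- move=> n s [fs Ls G0].
  have [j jn jP] : exists2 j, (j <= size (G s n.+1))%N &
      if n is 0 then j = 1%N else (C n.+1 (r s + j) \/ j = 0)%N /\
        (size (G s n.+1) = j \/ ~~ C n.+1 (r s + j).+1).
    case: n G0 {fs Ls} => [G0|n _].
      exists 1%N => //; rewrite G0// /letters /= size_map size_enum_ord; lia.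
    (* [j = 0] is always allowed: the letter removed at the start may already exceed the admissible
       codimension. *)
    pose Q j := (j <= size (G s n.+2))%N && (C n.+2 (r s + j)%N || (j == 0%N)).
    have exQ : exists j, Q j by exists 0%N; rewrite /Q eqxx orbT.
    have leQ j : Q j -> (j <= size (G s n.+2))%N by case/andP.
    case: (ex_maxnP exQ leQ) => j /andP[jn jC] maxj; exists j => //; split.
      by case/orP: jC => [->|/eqP ->]; [left|right].
    case: (eqVneq (size (G s n.+2)) j) => [|nj]; [by left|right].
    apply/negP => Cj; have : Q j.+1.
      by rewrite /Q addnS Cj andbT ltn_neqAle eq_sym nj.
    by move=> /maxj; rewrite ltnn.
  have [Gs' [ts' [s' G'n sz Bts]]] :=
    elim_weight R gr le_basic fs (Ls n.+1 (ltnSn n)) jn.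
  exists (Gs', (r s + j)%N, j, ts').
    split=> //; case: n jP {jn s' Bts Ls G0} sz G'n => // n [h1 h2] sz G'n.
    split=> //; case: h2 => h2; [left|by right].
    by move: sz; rewrite h2 subnn /G /= G'n => /size0nil ->.
  split=> //; first exact: es_free s'.
  by move=> m nm; apply: (es_homog s') => //; apply: Ls; exact: ltnW.
exists (fun n => G (st n)), (fun n => k (st n.+1)), (fun n => ts (st n.+1)).
have rE n : r (st n) = (\sum_(m < n) k (st m.+1))%N.
  elim: n => [|n IH]; first by rewrite big_ord0 st0.
  by rewrite big_ord_recr -IH; case: (stP n) => _ [].
split.
- by rewrite st0.
- by case: (stP 0%N) => _ [].
- by move=> n; case: (stP n) => _ [].
- by move=> n; case: (stP n) => _ [].
- by move=> [//|n] _; rewrite -rE; case: (stP n.+1) => _ [].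
Qed.

End Greedy.

(** * The density of the greedy subalgebra *)

Lemma bernoulli_ineq (R : realType) (y : R) n :
  0 <= y -> y <= 1 -> 1 - n%:R * y <= (1 - y) ^+ n.
Proof.
move=> y0 y1; elim: n => [|n IH]; first by rewrite mul0r subr0 expr0.
rewrite exprS -natr1; have n0 : 0 <= n%:R :> R by [].
by apply: (@le_trans _ _ ((1 - y) * (1 - n%:R * y))); [nra|rewrite ler_wpM2l//; lra].
Qed.

Lemma uniq_map_inj_in (T1 T2 : eqType) (f : T1 -> T2) (s : seq T1) :
  uniq (map f s) -> {in s &, injective f}.
Proof.
elim: s => //= z s IH /andP[zs us] u v; rewrite !inE.
move=> /predU1P[->|us'] /predU1P[->|vs'] // fuv; last exact: IH.
- by case/negP: zs; rewrite fuv map_f.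
- by case/negP: zs; rewrite -fuv map_f.
Qed.

Section Density.
Variables (R : realType) (F : fieldType) (L : lieAlgType F).
Variables (d : nat) (x : 'I_d -> L).
Hypotheses (d_ge2 : (2 <= d)%N) (freeL : free_on [set: L] [set: 'I_d] x).
Local Notation q := (d%:R^-1 : R).
Variables (pi : nat -> L -> L) (gr : grading x pi).
Local Notation b n := (quot_dim [set: L] (lie_gt x n)).

Variable l : nat -> nat.
Hypothesis l_basis : forall n, exists e : 'I_(\sum_(m < n) l m) -> L,
  quot_basis [set: L] (lie_gt x n) e.
Hypothesis l_prod :
  forall n, (\prod_(m < n) (1 - q ^+ m.+1) ^+ l m) * n.+1%:R <= 1.

Lemma dimE n : b n = (\sum_(m < n) l m)%N.
Proof.
by have [e eb] := l_basis n; rewrite (quot_dimE (lie_ge_subspace _ _) eb).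
Qed.

Lemma dim_le m n : (m <= n)%N -> (b m <= b n)%N.
Proof.
move=> mn; rewrite !dimE -!(big_mkord predT l).
by rewrite [leqRHS](big_cat_nat (n := m))//= leq_addr.
Qed.

(** Every factor in [l_prod] is at least a power of 1/2, so [n.+1 <= 2 ^ b n]; if all dimensions
    were at most [K], this would fail at [n = 2 ^ K]. *)
Lemma dim_unbounded K : exists N, forall n, (N <= n)%N -> (K <= b n)%N.
Proof.
suff [N KN] : exists N, (K <= b N)%N.
  by exists N => n /dim_le; exact: leq_trans.
apply: contrapT => nK; pose n := (2 ^ K)%N.
have bK : (b n <= K)%N.
  by rewrite leqNgt; apply/negP => /ltnW Kb; apply: nK; exists n.
have q0 := q_gt0 R d_ge2; have qh := q_le_half R d_ge2.
have : (2^-1 : R) ^+ b n <= \prod_(m < n) (1 - q ^+ m.+1) ^+ l m.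
  rewrite dimE -prodrXr; apply: ler_prod => m _.
  have qm : q ^+ m.+1 <= q.
    by rewrite exprS ler_piMr ?(ltW q0)// exprn_ile1 ?(ltW q0)//; lra.
  by rewrite exprn_ge0 ?invr_ge0//= lerXn2r ?nnegrE ?invr_ge0//; lra.
move=> /(ler_wpM2r (ler0n R n.+1)) /le_trans /(_ (l_prod n)).
rewrite exprVn mulrC ler_pdivrMr ?exprn_gt0// mul1r -natrX ler_nat.
by rewrite leqNgt ltnS leq_pexp2l.
Qed.

Lemma den_itv M : lie_subalg M -> 0 <= den x R M <= 1.
Proof.
move=> sM; apply: limn_inf_itv => n; rewrite divr_ge0//=.
(* For [b n = 0], as at [n = 0], the quotient is 0 because [0^-1 = 0]. *)
have [->|b0] := eqVneq (b n) 0%N; first by rewrite invr0 mulr0.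
rewrite ler_pdivrMr ?ltr0n ?lt0n// mul1r ler_nat.
rewrite dimE; have [e [_ espan _]] := l_basis n.
by apply: (quot_dim_le (e := e) (lie_ge_subspace _ _)) => v _; exact: espan.
Qed.

Lemma den_full : den x R [set: L] = 1.
Proof.
have [N hN] := dim_unbounded 1.
have E n : sum_set [set: L] (lie_gt x n) = [set: L].
  apply/seteqP; split=> // u _; apply: sum_setl => //; exact: lie_ge_subspace.
rewrite /den; under [X in limn_inf X]eq_fun do rewrite E.
apply: limn_inf_eq.
  by exists N => n /hN b0; rewrite divff// pnatr_eq0; lia.
move=> e M e0; exists (maxn N M); first exact: leq_maxr.
rewrite divff; last by rewrite pnatr_eq0; have := hN _ (leq_maxl N M); lia.
by rewrite lerDl ltW.
Qed.

Lemma den_zero : den x R [set 0] = 0.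
Proof.
have E n : sum_set [set 0] (lie_gt x n) = lie_gt x n.
  have s0 : lin_subspace [set (0 : L)].
    by apply/lin_subspaceP; split=> // a _ _ -> ->; rewrite scaler0 addr0.
  apply/seteqP; split=> [_ [_ -> [v Lv <-]]|]; first by rewrite add0r.
  exact: sum_setr.
have Z n : quot_dim (lie_gt x n) (lie_gt x n) = 0%N.
  apply: (quot_dimE (lie_ge_subspace _ _)); apply: quot_basis_refl.
  exact: (lin_subspace0 (lie_ge_subspace _ _)).
rewrite /den; under [X in limn_inf X]eq_fun do rewrite E Z mul0r.
apply: limn_inf_eq; first by exists 0%N.
by move=> e N e0; exists N => //; rewrite add0r ltW.
Qed.

Variables (le : rel (liecomm d)) (le_basic : basic_order le).
Local Notation ev := (lie_eval x).
Variable a : R.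
Hypotheses (a_gt0 : 0 < a) (a_lt1 : a < 1).

(** For codimension [r] in weights at most [n] this says that the subalgebra has at least [a] times
    the dimension of [L] there. *)
Let C n r := a * (b n)%:R + r%:R <= (b n)%:R.

Section GreedyDensity.
Variables (st : nat -> nat -> seq L) (k : nat -> nat).
Hypotheses (st0 : st 0%N = letters x) (k0 : k 0%N = 1%N).
Hypothesis st_step : forall n, elim_step R x n.+1 (k n) (st n) (st n.+1).
Hypothesis greedy : forall n, (0 < n)%N ->
  (C n.+1 (\sum_(m < n.+1) k m) \/ k n = 0)%N /\
  (st n.+1 n.+1 = [::] \/ ~~ C n.+1 (\sum_(m < n.+1) k m).+1%N).

Let r n := (\sum_(m < n) k m)%N.
Let M := lie_gen (gens (limit_fam st)).
Let am n := quot_dim (sum_set M (lie_gt x n)) (lie_gt x n).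

Let st0_free : free_fam x (st 0%N).
Proof. by rewrite st0; exact: letters_free. Qed.

Let st0_gen : lie_gen (gens (st 0%N)) = setT.
Proof. by rewrite st0 gen_letters. Qed.

Let rS n : r n.+1 = (r n + k n)%N. Proof. by rewrite /r big_ord_recr. Qed.

Lemma greedy_codim n : (r n + am n)%N = b n.
Proof.
have [e eb] := l_basis n; have [e' eb'] := process_basis st_step n.
rewrite st0_gen in eb'; rewrite /am (limit_sum gr st0_free st0_gen st_step) dimE.
apply: quot_dim_add eb eb' => //; first exact: lie_gen_subspace.
- exact: lie_ge_subspace.
- exact: (process_gt st0_gen st_step).
Qed.

(** Admissibility persists, since otherwise nothing is removed and the dimension of [L] does not
    drop. It is reached: until then only one letter is removed, and [1 <= (1 - a) * b n] holds
    eventually. *)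
Lemma greedy_ge : exists N, forall n, (N <= n)%N -> C n (r n).
Proof.
suff [N [N0 CN]] : exists N, (0 < N)%N /\ C N (r N).
  exists N => n /subnKC <-; elim: (n - N)%N => [|i]; first by rewrite addn0.
  rewrite addnS; set n' := (N + i)%N => Cn.
  have [[//|k0']] := greedy (n := n') (ltn_addr _ N0).
  rewrite rS k0' addn0 => _; move: Cn; rewrite /C.
  have : (b n')%:R <= (b n'.+1)%:R :> R by rewrite ler_nat dim_le.
  by have := a_lt1; nra.
apply: contrapT => nC.
have r1 n : (0 < n)%N -> r n = 1%N.
  elim: n => // -[_ _|n IH _]; first by rewrite /r big_ord1.
  rewrite rS IH//; have [[Cn|->//]] := greedy (n := n.+1) isT.
  by case: nC; exists n.+2.
have /archi_boundP : 0 <= (1 - a)^-1 by rewrite invr_ge0; have := a_lt1; lra.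
set K := Num.bound _ => hK.
have [N hN] := dim_unbounded K; apply: nC; exists N.+1; split=> //.
rewrite r1// /C; have : K%:R <= (b N.+1)%:R :> R by rewrite ler_nat hN.
have a1 : 0 < 1 - a by rewrite subr_gt0.
have : 1 < K%:R * (1 - a) by rewrite -ltr_pdivrMr// div1r.
by nra.
Qed.

(* The removal of a letter makes the defect of [M] at [1/d] at least [d^-N1], so
   the defect is still nonnegative at the slightly larger point [t], whence
   [dim M_{<= n} = O(t^-n)]. *)
Lemma greedy_finite_absurd N : (forall n, (N <= n)%N -> st n n = [::]) -> False.
Proof.
move=> stN; have [N0 hC] := greedy_ge.
pose N1 := maxn N 1.
have {}stN n : (N1 <= n)%N -> limit_fam st n = [::].
  by rewrite geq_max => /andP[/stN].
have N1_gt0 : (0 < N1)%N by rewrite leq_maxr.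
clearbody N1.
have q0 := q_gt0 R d_ge2; have qh := q_le_half R d_ge2.
have q1 := q_lt1 R d_ge2.
have fr := limit_free st0_free st0_gen st_step.
pose B := gcount (limit_fam st).
have E0 m : 0 <= defect q (gcount (st 0%N)) m by rewrite st0 defect_letters.
have qN0 : 0 < q ^+ N1 by rewrite exprn_gt0.
have sumq : \sum_(m < N1.+1) (B m)%:R * q ^+ m <= 1 - q ^+ N1.
  have := process_defect_low st_step q0 q1 E0 N1 _ N1_gt0.
  rewrite k0 /defect => /(_ isT); rewrite lerBrDl -lerBrDr.
  congr (_ <= _); apply: eq_bigr => m _.
  by rewrite /B /gcount -(limit_famE st_step (n := N1))// -ltnS ltn_ord.
(* By Bernoulli [(1 - eta) ^+ N1 >= 1 - q ^+ N1], which keeps the defect nonnegative at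
   [t = q / (1 - eta)]. The denominator [N1.+1 >= 2] also gives [eta <= 1/4], whence
   [t^-1 = (1 - eta) d >= 3/2]. *)
pose eta := q ^+ N1 / N1.+1%:R.
have N2 : 2 <= N1.+1%:R :> R by rewrite ler_nat.
have qN1q : q ^+ N1 <= q.
  case: (N1) N1_gt0 => // i _.
  by rewrite exprS ler_piMr ?(ltW q0)// exprn_ile1 ?(ltW q0)// ltW.
have eta_gt0 : 0 < eta by rewrite divr_gt0// ltr0n.
have eta_le : eta <= 4^-1.
  by rewrite /eta ler_pdivrMr ?ltr0n//; nra.
have bern : 1 - q ^+ N1 <= (1 - eta) ^+ N1.
  apply: le_trans (bernoulli_ineq N1 (ltW eta_gt0) _); last by lra.
  rewrite lerD2l lerN2 /eta mulrA ler_pdivrMr ?ltr0n// mulrC.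
  by rewrite ler_pM2l// ler_nat.
pose t := q / (1 - eta).
have e1 : 0 < 1 - eta by lra.
have t0 : 0 < t by rewrite divr_gt0.
have t1 : t < 1 by rewrite /t ltr_pdivrMr// mul1r; lra.
have tq m : (m <= N1)%N -> t ^+ m <= q ^+ m / (1 - eta) ^+ N1.
  move=> mN; rewrite /t expr_div_n ler_pM2l ?exprn_gt0//.
  rewrite lef_pV2 ?posrE ?exprn_gt0// -(subnKC mN) exprD.
  apply: ler_piMr; first by rewrite exprn_ge0// ltW.
  by apply: exprn_ile1; lra.
have Et m : 0 <= defect t B m.
  rewrite /defect subr_ge0.
  apply: (@le_trans _ _ (\sum_(i < N1.+1) (B i)%:R * t ^+ i)).
    rewrite -!(big_mkord predT (fun i => (B i)%:R * t ^+ i)).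
    have [mN|Nm] := leqP m N1.
      rewrite [leRHS](big_cat_nat (n := m.+1))//= lerDl sumr_ge0// => i _.
      by rewrite mulr_ge0// exprn_ge0// ltW.
    rewrite [leLHS](big_cat_nat (n := N1.+1))//=; last exact: ltnW.
    rewrite gerDl big_nat big1// => i /andP[Ni _].
    by rewrite /B /gcount stN ?mul0r// ltnW.
  apply: (@le_trans _ _ (\sum_(i < N1.+1) (B i)%:R * (q ^+ i / (1 - eta) ^+ N1))).
    by apply: ler_sum => i _; rewrite ler_wpM2l// tq// -ltnS ltn_ord.
  under eq_bigr do rewrite mulrA.
  rewrite -mulr_suml ler_pdivrMr ?exprn_gt0// mul1r.
  exact: le_trans sumq bern.
have tV : t^-1 = (1 - eta) * d%:R by rewrite /t invf_div invrK.
have d2 : 2 <= d%:R :> R by rewrite ler_nat.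
have rho : 3 / 2 <= t^-1 by rewrite tV; nra.
have qt : q * t^-1 < 1.
  have dn0 : d%:R != 0 :> R by rewrite pnatr_eq0 -lt0n ltnW.
  by rewrite tV mulrCA mulVf// mulr1 gtrBl.
(* Admissibility gives [a * b n <= dim M], and [dim M] is at most the sum of the powers of [t^-1],
   hence at most [3 * t^-1 ^+ n]: so [L] itself would grow at a rate below [d]. *)
apply: (subexponential_absurd (C := 3 / a) (N0 := N0) q0 qh rho qt _ l_prod).
move=> n N0n; rewrite -dimE mulrAC ler_pdivlMr// mulrC.
have := sum_power_le n rho; apply: le_trans.
apply: le_trans (quot_dim_gt_le gr n fr t0 t1 Et).
have := hC n N0n; rewrite /C -(greedy_codim n) natrD.
by rewrite [leRHS]addrC lerD2r.
Qed.

(** Otherwise one further removal would be admissible in all large weights; the greedy choice would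
    then have removed every generator there, leaving a finite family. *)
Lemma greedy_le N : exists2 n, (N <= n)%N & ~~ C n (r n).+1.
Proof.
apply: contrapT => nN; apply: (@greedy_finite_absurd N.+2) => -[//|[//|n]].
rewrite !ltnS => Nn; have [_ [//|nC]] := greedy (n := n.+1) isT.
by case: nN; exists n.+2 => //; lia.
Qed.

(** [greedy_ge] bounds the quotients below by [a]; whenever one more removal is inadmissible, the
    quotient is less than [a + 1 / b n]. *)
Lemma greedy_den : den x R M = a.
Proof.
have amE n : (am n)%:R = (b n)%:R - (r n)%:R :> R.
  by rewrite -(greedy_codim n) natrD addrAC subrr add0r.
have [N1 hN1] := dim_unbounded 1.
have b_gt0 n : (N1 <= n)%N -> 0 < (b n)%:R :> R.
  by move=> /hN1; rewrite ltr0n.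
apply: limn_inf_eq.
  have [N hN] := greedy_ge; exists (maxn N N1) => n.
  rewrite geq_max => /andP[/hN Cn /b_gt0 bn].
  by rewrite ler_pdivlMr// -/(am n) amE lerBrDr.
move=> e N e0; have /archi_boundP : 0 <= e^-1 by rewrite invr_ge0 ltW.
set K := Num.bound _ => hK; have [N2 hN2] := dim_unbounded K.
have [n] := greedy_le (maxn N (maxn N1 N2)).
rewrite !geq_max => /and3P[Nn /b_gt0 bn /hN2 Kn].
rewrite /C -ltNge => nC; exists n => //.
rewrite ler_pdivrMr// -/(am n) amE mulrDl.
have : 1 <= e * (b n)%:R.
  have : e^-1 < (b n)%:R by apply: lt_le_trans hK _; rewrite ler_nat.
  by rewrite -(ltr_pM2l e0) divff ?gt_eqF// => /ltW.
by move: nC; rewrite -natr1; lra.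
Qed.

End GreedyDensity.

Lemma greedy_subalgebra :
  exists (M : set L) (S : set (liecomm d)),
    [/\ lie_subalg M, S `<=` [set t | basic le t],
        M = lie_gen [set ev t | t in S], free_on M S ev & den x R M = a].
Proof.
have [st [k [ts [st0 k0 st_step st_ts greedy]]]] :=
  greedy_process R d_ge2 freeL gr le_basic C.
have st0_free : free_fam x (st 0%N) by rewrite st0; exact: letters_free.
have st0_gen : lie_gen (gens (st 0%N)) = setT by rewrite st0 gen_letters.
have [nil0 uB _ frB] := limit_free st0_free st0_gen st_step.
pose S := [set t | exists n, t \in ts n].
have evS : [set ev t | t in S] = gens (limit_fam st).
  apply/seteqP; split=> [_ [t [n tn] <-]|u [[|n] un]].
  - by exists n.+1; rewrite /limit_fam (st_ts n).1 map_f.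
  - by rewrite nil0 in un.
  - move: un; rewrite /limit_fam (st_ts n).1 => /mapP[t tn ->].
    by exists t => //; exists n.
(* Needed to turn values prescribed on commutators into values on elements of [L]. Different weights
   are separated by the grading, equal weights by the absence of duplicates. *)
have ev_inj t t' : S t -> S t' -> ev t = ev t' -> t = t'.
  move=> [n tn] [n' tn'] tt'.
  have B_t m s : s \in ts m -> ev s \in limit_fam st m.+1.
    by move=> sm; rewrite /limit_fam (st_ts m).1 map_f.
  have [nn'] : n.+1 = n'.+1.
    apply: (free_fam_disjoint gr (limit_free st0_free st0_gen st_step) (B_t _ _ tn)).
    by rewrite tt'; exact: B_t.
  rewrite -nn' in tn'.
  have := uB n.+1; rewrite /limit_fam (st_ts n).1 => /uniq_map_inj_in.
  exact.
exists (lie_gen (gens (limit_fam st))), S; split.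
- exact: lie_gen_subalg.
- by move=> t [n /(st_ts n).2[]].
- by rewrite evS.
- split; first exact: lie_gen_subalg.
    by move=> t St; apply: lie_gen_sub; rewrite -evS; exists t.
  move=> K y.
  have [f [hf fy]] := frB K (fun u =>
    if pselect (exists2 t, S t & ev t = u) is left p
    then y (projT1 (cid2 p)) else 0).
  have fev t : S t -> f (ev t) = y t.
    move=> St; rewrite fy; last by rewrite -evS; exists t.
    case: pselect => [p|np]; last by case: np; exists t.
    case: (cid2 p) => t' St' tt'; congr y; exact: ev_inj.
  exists f; split=> // g hg gy; apply: lie_hom_eq hg hf _ => u.
  by rewrite -evS => -[t St <-]; rewrite gy// fev.
- exact: (greedy_den st0 k0 st_step greedy).
Qed.

End Density.

(** The endpoints are treated apart, since the greedy choice always removes a letter and the growth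
    bound divides by [a]: the empty set of generators gives density 0, all letters give density
    1. *)
Lemma lie_density_exists (R : realType) (F : fieldType) (d : nat) (hd : (2 <= d)%N)
    (L : lieAlgType F) (x : 'I_d -> L)
    (freeL : free_on [set: L] [set: 'I_d] x) (le : rel (liecomm d)) (a : R) :
  basic_order le -> 0 <= a <= 1 ->
  exists (M : set L) (S : set (liecomm d)),
    [/\ lie_subalg M, S `<=` [set t | basic le t],
        M = lie_gen [set lie_eval x t | t in S],
        free_on M S (lie_eval x) & den x R M = a].
Proof.
move=> le_basic /andP[a0 a1].
have [pi gr] := grading_exists freeL.
have [l [l_basis l_prod]] := lie_dim R hd freeL gr.
have [a_gt0|] := ltP 0 a; last first.
  move=> a_le0; have -> : a = 0 by apply/eqP; rewrite eq_le a_le0.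
  have E : lie_gen [set lie_eval x t | t in set0] = [set 0].
    apply/seteqP; split=> [|_ ->].
      apply: lie_gen_min; last by move=> u [t].
      by apply: lie_subalg_intro => //= [b u v -> ->|u v -> _];
        rewrite ?scaler0 ?addr0 ?lie0l.
    exact: (lin_subspace0 (lie_gen_subspace _)).
  exists [set 0], set0; split=> //.
  - by rewrite -E; exact: lie_gen_subalg.
  - rewrite -E; split=> [|//|K y]; first exact: lie_gen_subalg.
    exists (fun=> 0); split=> // [|g hg _].
      by split=> *; rewrite ?scaler0 ?addr0 ?lie0l.
    rewrite E => _ ->; exact: (lie_hom0 (lie_gen_subalg _) hg).
  - exact: den_zero.
have [a_lt1|] := ltP a 1.
  exact: (greedy_subalgebra hd freeL gr l_basis l_prod le_basic a_gt0 a_lt1).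
move=> a_ge1; have -> : a = 1 by apply/eqP; rewrite eq_le a1.
have E : [set lie_eval x t | t in range (@Gen d)] = range x.
  apply/seteqP; split=> [_ [_ [i _ <-] <-]|_ [i _ <-]]; first by exists i.
  by exists (Gen i) => //; exists i.
exists setT, (range (@Gen d)); split.
- exact: lie_subalgT.
- by move=> _ [i _ <-].
- by rewrite E (free_on_generates freeL).
- split=> // [|K y]; first exact: lie_subalgT.
  have [_ _ fr] := freeL; have [f [hf fx fu]] := fr K (fun i => y (Gen i)).
  exists f; split=> // [_ [i _ <-]|g hg gy]; first by rewrite /= fx.
  by apply: fu => // i _; rewrite -gy//; exists i.
- exact: (den_full hd l_basis l_prod).
Qed.

Theorem theorem4p10 (R : realType) (p : nat) (hp : prime p)
    (d : nat) (hd : (2 <= d)%N)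
    (L : lieAlgType 'F_p) (x : 'I_d -> L)
    (freeL : free_on [set: L] [set: 'I_d] x) :
  (forall le : rel (liecomm d), basic_order le ->
    forall alpha : R, 0 <= alpha <= 1 ->
    exists (M : set L) (S : set (liecomm d)),
      [/\ lie_subalg M,
          S `<=` [set t | basic le t],
          M = lie_gen [set lie_eval x t | t in S],
          free_on M S (lie_eval x)
        & den x R M = alpha])
  /\ dspec x R = `[0, 1]%classic.
Proof.
have H := fun le leb alpha => @lie_density_exists R _ d hd L x freeL le alpha leb.
split; first exact: H.
apply/seteqP; split=> [_ [M sM <-]|a].
  have [pi gr] := grading_exists freeL.
  have [l [l_basis _]] := lie_dim R hd freeL gr.
  by rewrite /= in_itv /=; apply: (den_itv R l_basis).
rewrite /= in_itv /= => a01; have [le leb] := basic_order_exists d.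
by have [M [S [sM _ _ _ Ma]]] := H le leb a a01; exists M.
Qed.
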